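(* There is an absolute constant $c>0$ such that the following holds. Let $T$ be a hierarchically well separated tree (HST) with parameter $2$, and let $R$ be any finite set of queueing requests issued, in an arbitrarily dynamic (possibly concurrent) manner, at the leaves of $T$, together with the dummy request $r_0=(v_0,0)$ at a leaf $v_0$. Then for every execution of the Arrow protocol on $T$ with request set $R$ — synchronous or asynchronous — the total cost of Arrow is at most $c\cdot \mathrm{OPT}_T(R)$.
   Context: HST with parameter $2$ and depth $h$: a rooted edge-weighted tree in which all leaves are at the same depth $h$; levels are numbered so that leaves are on level $0$ and the root is on level $h$, and every edge joining a level-$\ell$ node to one of its children (on level $\ell-1$) has length $2^{\ell-1}$. Thus two leaves whose lowest common ancestor is on level $\ell$ are at tree distance $\delta(\ell)=2^{\ell+1}-2$. $d_T$ denotes the weighted tree distance. Requests: a request is a pair $r=(v,t)$ meaning it is issued at node $v$ at time $t\ge 0$. There is a dummy request $r_0=(v_0,0)$ that defines the initial tail of the queue and must be ordered first. Arrow protocol on a weighted tree $T$: each node $u$ stores a pointer $\mathrm{link}(u)\in\{u\}\cup\{\text{neighbours of }u\}$. Initially $\mathrm{link}(v_0)=v_0$ and every other node points to its neighbour on the tree path towards $v_0$. When a request $r$ is issued at node $v$: if $\mathrm{link}(v)=v$, then $r$ is queued directly behind the previous request issued at $v$; otherwise, atomically, a message $\mathrm{find}(r)$ is sent to $u=\mathrm{link}(v)$ and $\mathrm{link}(v)$ is set to $v$. When a node $u$ receives $\mathrm{find}(r)$ from a neighbour $w$: if $\mathrm{link}(u)=u$, atomically $r$ is queued directly behind the last request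 issued at $u$ (which becomes $r$'s predecessor) and $\mathrm{link}(u)$ is set to $w$; otherwise, atomically, $\mathrm{find}(r)$ is forwarded to $\mathrm{link}(u)$ and $\mathrm{link}(u)$ is set to $w$. This produces a total order $r_0,r_1,\dots,r_{|R|-1}$ of the requests. Executions: in a synchronous execution a message over edge $e$ takes exactly time $w(e)$; in an asynchronous execution message delays are arbitrary but the delay over edge $e$ is at most $w(e)$. Cost of Arrow: the latency of $r_i=(v_i,t_i)$, $i\ge1$, is $t^*_i-t_i$, where $t^*_i$ is the time at which the node of its predecessor $r_{i-1}$ learns about $r_i$ (receives $\mathrm{find}(r_i)$); the total cost is the sum of the latencies of $r_1,\dots,r_{|R|-1}$. Optimal offline cost on a weighted graph $H$: $\mathrm{OPT}_H(R)=\min_\pi\sum_{i=1}^{|R|-1}\max\{d_H(v_{\pi(i-1)},v_{\pi(i)}),\,t_{\pi(i-1)}-t_{\pi(i)}\}$, the minimum over all orderings $\pi$ of the requests with $\pi(0)=0$ (dummy request first). *)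

(* Defs.v *)
From mathcomp Require Import all_boot.
From Stdlib Require Import Reals.

Set Implicit Arguments.
Unset Strict Implicit.
Unset Printing Implicit Defensive.

(* HST with parameter 2 and depth h.                                   *)
(* A node is the sequence of child indices on the path from the root;  *)
(* deg p is the number of children of node p.  The node p has depth    *)
(* size p and lies on level h - size p (leaves: level 0, root: level h)*)

Definition is_node (h : nat) (deg : seq nat -> nat) (p : seq nat) : Prop :=
  (size p <= h)%N /\ forall k, (k < size p)%N -> (nth 0%N p k < deg (take k p))%N.

Definition is_leaf (h : nat) (deg : seq nat -> nat) (p : seq nat) : Prop :=
  is_node h deg p /\ size p = h.

(* every non-leaf node has at least one child: all leaves are at depth h *)
Definition hst_wf (h : nat) (deg : seq nat -> nat) : Prop :=
  forall p, is_node h deg p -> (size p < h)%N -> (0 < deg p)%N.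

Definition level (h : nat) (p : seq nat) : nat := (h - size p)%N.

(* length of the edge joining a node of depth k to its child (depth k+1):
   the parent is on level l = h - k, the length is 2^(l-1). *)
Definition edge_len (h k : nat) : nat := expn 2 (h - k).-1.

(* length of the longest common prefix = depth of the lowest common ancestor *)
Fixpoint lcp (u v : seq nat) : nat :=
  match u, v with
  | x :: u', y :: v' => if x == y then (lcp u' v').+1 else 0%N
  | _, _ => 0%N
  end.

(* weighted tree distance: path from u up to the LCA, then down to v *)
Definition dT (h : nat) (u v : seq nat) : R :=
  INR ((\sum_(lcp u v <= k < size u) edge_len h k)
       + (\sum_(lcp u v <= k < size v) edge_len h k))%N.

(* Requests: the full request list is  (v0,0) :: rs ; index 0 is the   *)
(* dummy request r0, index i >= 1 is the request nth rs (i-1).          *)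

Definition reqs (v0 : seq nat) (rs : seq (seq nat * R)) : seq (seq nat * R) :=
  (v0, 0%R) :: rs.

Definition rnode (Rq : seq (seq nat * R)) (i : nat) : seq nat :=
  (nth ([::], 0%R) Rq i).1.
Definition rtime (Rq : seq (seq nat * R)) (i : nat) : R :=
  (nth ([::], 0%R) Rq i).2.

(* a message find(r) in transit: (request index, sender, receiver, arrival time) *)
Definition message := (nat * seq nat * seq nat * R)%type.

Record state := State {
  link  : seq nat -> seq nat;
  lastq : seq nat -> nat;             (* last request issued at each node *)
  msgs  : seq message;
  pend  : seq nat;                    (* requests not yet issued *)
  now   : R;                          (* time of the last processed event *)
  out   : nat -> option (nat * R)     (* out i = Some (pred, t*_i) once ordered *)
}.

Definition upd {A : Type} (f : seq nat -> A) (x : seq nat) (y : A) : seq nat -> A :=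
  fun z => if z == x then y else f z.

Definition updo (f : nat -> option (nat * R)) (i : nat) (y : option (nat * R)) :=
  fun j => if j == i then y else f j.

(* neighbour of u on the tree path towards v0 *)
Definition toward (v0 u : seq nat) : seq nat :=
  if (size u < size v0)%N && (take (size u) v0 == u)
  then take (size u).+1 v0
  else take (size u).-1 u.

Definition init_state (v0 : seq nat) (rs : seq (seq nat * R)) : state :=
  State (fun z => if z == v0 then v0 else toward v0 z)
        (fun _ => 0%N) [::] (iota 1 (size rs)) 0%R (fun _ => None).

(* One atomic step.  Message delays over an edge e are arbitrary in
   [0, w(e)] (asynchronous executions; synchronous ones are the special
   case delay = w(e)); simultaneous events are ordered arbitrarily. *)
Inductive step (h : nat) (Rq : seq (seq nat * R)) : state -> state -> Prop :=
| step_issue_local : forall lk lq ms p1 p2 i nw o,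
    let v := rnode Rq i in
    (nw <= rtime Rq i)%R ->
    lk v = v ->
    step h Rq (State lk lq ms (p1 ++ i :: p2) nw o)
              (State lk (upd lq v i) ms (p1 ++ p2) (rtime Rq i)
                     (updo o i (Some (lq v, rtime Rq i))))
| step_issue_send : forall lk lq ms p1 p2 i nw o arr,
    let v := rnode Rq i in
    (nw <= rtime Rq i)%R ->
    lk v <> v ->
    (rtime Rq i <= arr <= rtime Rq i + dT h v (lk v))%R ->
    step h Rq (State lk lq ms (p1 ++ i :: p2) nw o)
              (State (upd lk v v) (upd lq v i) ((i, v, lk v, arr) :: ms)
                     (p1 ++ p2) (rtime Rq i) o)
| step_recv_queue : forall lk lq m1 m2 i w u arr ps nw o,
    (nw <= arr)%R ->
    lk u = u ->
    step h Rq (State lk lq (m1 ++ (i, w, u, arr) :: m2) ps nw o)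
              (State (upd lk u w) lq (m1 ++ m2) ps arr
                     (updo o i (Some (lq u, arr))))
| step_recv_forward : forall lk lq m1 m2 i w u arr ps nw o arr',
    (nw <= arr)%R ->
    lk u <> u ->
    (arr <= arr' <= arr + dT h u (lk u))%R ->
    step h Rq (State lk lq (m1 ++ (i, w, u, arr) :: m2) ps nw o)
              (State (upd lk u w) lq ((i, u, lk u, arr') :: (m1 ++ m2)) ps arr o).

Inductive reach (h : nat) (Rq : seq (seq nat * R)) : state -> state -> Prop :=
| reach_refl : forall s, reach h Rq s s
| reach_step : forall s1 s2 s3, step h Rq s1 s2 -> reach h Rq s2 s3 -> reach h Rq s1 s3.

Definition complete (s : state) : Prop := pend s = [::] /\ msgs s = [::].

Definition learn_time (s : state) (i : nat) : R :=
  match out s i with Some (_, t) => t | None => 0%R end.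

Definition Rsum (l : seq R) : R := foldr Rplus 0%R l.

Definition arrow_cost (Rq : seq (seq nat * R)) (s : state) : R :=
  Rsum (map (fun i => learn_time s i - rtime Rq i)%R (iota 1 (size Rq).-1)).

Definition pair_cost (h : nat) (Rq : seq (seq nat * R)) (a b : nat) : R :=
  Rmax (dT h (rnode Rq a) (rnode Rq b)) (rtime Rq a - rtime Rq b).

(* cost of the ordering 0 :: p (dummy request first) *)
Definition order_cost (h : nat) (Rq : seq (seq nat * R)) (p : seq nat) : R :=
  Rsum (pairmap (pair_cost h Rq) 0%N p).

Definition OPT (h : nat) (Rq : seq (seq nat * R)) : R :=
  let cs := map (order_cost h Rq) (permutations (iota 1 (size Rq).-1)) in
  foldr Rmin (head 0%R cs) cs.

(* Main.v *)
Require Import Defs.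
From Stdlib Require Import Reals Lra FunctionalExtensionality.
From mathcomp Require Import all_boot zify.

Set Implicit Arguments.
Unset Strict Implicit.
Unset Printing Implicit Defensive.

(* Number the requests in the order in which Arrow queues them, and let [t i] and
   [ts i] be the times at which request [i] is issued and at which its
   predecessor learns about it.  For all [j >= i], Arrow satisfies
   [ts i <= t j + d j (i - 1)]: a signal sent by [j] towards the predecessor of
   [i] meets, at every node on its way, messages that are at least as early.  So
   the order is a nearest-neighbour path for the cost distance plus elapsed
   time, with steps [c i = ts i - t (i - 1)].

   The leaves of an HST form an ultrametric space.  Call a hop of an offline
   order light at scale [D] if its distance and its time difference are both
   below [D / 4].  A run of light hops stays in one ball of radius [D / 4], and
   there a step with [D <= c (a + 1)] separates the requests up to [a] from the
   later ones by a time gap of length [D / 2].  Hence a run contains at most one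
   such [a], and the number of steps of length at least [D] is at most the
   number of hops that are not light.  Integrating over [D] bounds the sum of
   the [c i] by 4 times the length of the offline order, in which forward moves
   in time are also charged.

   The offline optimum does not pay for such moves.  A time interval that it
   crosses only once, upwards, is therefore shortened first, keeping as much of
   it as the cost incurred around it pays for.  This preserves the
   nearest-neighbour property, and makes the total variation of time along the
   offline order at most 5 times its cost. *)

(* mathcomp rebinds the key R to its ring scope. *)
Delimit Scope R_scope with R.
Local Open Scope R_scope.

(** * Nearest-neighbour paths over an ultrametric *)

Definition rleb (x y : R) : bool := if Rle_dec x y then true else false.

Lemma rlebP x y : reflect (x <= y) (rleb x y).
Proof. by rewrite /rleb; case: Rle_dec => h; constructor. Qed.

Lemma Rsum_cat (s1 s2 : seq R) : Rsum (s1 ++ s2) = Rsum s1 + Rsum s2.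
Proof. by elim: s1 => [|x s IH] /=; rewrite ?IH; lra. Qed.

Lemma has_split T (P : pred T) (s : seq T) :
  has P s -> exists s1 x s2, s = s1 ++ x :: s2 /\ P x.
Proof.
elim: s => //= x s IH /orP [Px|/IH [s1 [y [s2 [-> Py]]]]].
  by exists [::], x, s.
by exists (x :: s1), y, s2.
Qed.

Lemma max_split (x : R) (s : seq R) :
  exists s1 m s2, x :: s = s1 ++ m :: s2 /\ all (fun y => rleb y m) (x :: s).
Proof.
elim: s x => [|y s IH] x.
  by exists [::], x, [::]; split => //=; rewrite andbT; apply/rlebP; lra.
have [s1 [m [s2 [E H]]]] := IH y.
case: (Rle_dec x m) => hx.
  exists (x :: s1), m, s2; rewrite E; split => //.
  by rewrite /= -E H andbT; apply/rlebP.
exists [::], x, (y :: s); split => //; rewrite /=.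
apply/andP; split; first by apply/rlebP; lra.
move: H; rewrite -[_ && _]/(all _ (y :: s)); apply: sub_all => z /rlebP h.
by apply/rlebP; lra.
Qed.

(* Layer-cake comparison: both sums are integrals of the tail counts. *)
Lemma Rsum_le_counts (cs ws : seq R) :
  (forall w, List.In w ws -> 0 <= w) ->
  (forall D, 0 < D -> (count (rleb D) cs <= count (rleb D) ws)%N) ->
  Rsum cs <= Rsum ws.
Proof.
have [k] := ubnP (size cs); elim: k cs ws => // k IH cs ws.
have ge0 (s : seq R) : (forall w, List.In w s -> 0 <= w) -> 0 <= Rsum s.
  elim: s => [|x s IHs] h /=; first lra.
  have := h x (or_introl erefl); have := IHs (fun w hw => h w (or_intror hw)).
  lra.
case: cs => [|c cs] hk hw hc; first by apply: ge0.
(* The largest entry [m] is removed together with some [w >= m] of [ws]. Counts at levels up to [m]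
   drop by one on both sides; above [m] the list [cs] has no entries. *)
have [s1 [m [s2 [E hm]]]] := max_split c cs.
rewrite E in hm hc hk *.
case: (Rle_dec m 0) => hm0.
  have := ge0 _ hw; suff: Rsum (s1 ++ m :: s2) <= 0 by lra.
  elim: (s1 ++ _) hm => [|x s IHs] /=; first by move=> _; lra.
  by case/andP=> /rlebP hx /IHs; lra.
have hmp : 0 < m by lra.
have : has (rleb m) ws.
  rewrite has_count; apply: leq_trans (hc m hmp); rewrite count_cat /=.
  have -> : rleb m m by apply/rlebP; lra.
  lia.
case/has_split=> w1 [w [w2 [Ew /rlebP hwm]]].
suff : Rsum (s1 ++ s2) <= Rsum (w1 ++ w2).
  by rewrite Ew !Rsum_cat /=; lra.
apply: IH.
- by move: hk; rewrite !size_cat /=; lia.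
- move=> x hx; apply: hw; rewrite Ew; apply: List.in_or_app.
  by case: (List.in_app_or _ _ _ hx); [left|right; right].
move=> D hD; have := hc D hD; rewrite Ew !count_cat /=.
case: (rlebP D m) => hDm.
  by have -> : rleb D w by [apply/rlebP; lra]; lia.
move=> _; suff : count (rleb D) (s1 ++ s2) = 0%N by rewrite count_cat; lia.
apply/eqP; rewrite -leqn0 leqNgt -has_count; apply/negP.
case/has_split=> u1 [u [u2 [Eu /rlebP hu]]].
move: hm; rewrite all_cat /= => /and3P [h1 _ h2].
have : all (rleb^~ m) (s1 ++ s2) by rewrite all_cat h1.
by rewrite Eu all_cat /= => /and3P [_ /rlebP ? _]; lra.
Qed.

(** Heavy edges cut the path into one more run than their number, and a run without heavy edges
    meets [P] at most once. *)
Lemma count_isolated (P : pred nat) (heavy : rel nat) (N : nat) :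
  (forall x q, uniq (x :: q) -> all (leq^~ N) (x :: q) ->
     path (fun a b => ~~ heavy a b) x q -> P x -> P (last x q) -> q = [::]) ->
  forall x p, uniq (x :: p) -> all (leq^~ N) (x :: p) ->
  (count P (x :: p) <= (count id (pairmap heavy x p)).+1)%N.
Proof.
move=> H.
(* The second half treats a current run that already contains a point of [P]: the next such point
   has to wait for a heavy edge, which saves the [.+1]. *)
have main : forall p y,
  (uniq (y :: p) -> all (leq^~ N) (y :: p) ->
     (count P p <= (count id (pairmap heavy y p)).+1)%N) /\
  (forall x q, P x -> last x q = y -> path (fun a b => ~~ heavy a b) x q ->
     uniq (x :: q ++ p) -> all (leq^~ N) (x :: q ++ p) ->
     (count P p <= count id (pairmap heavy y p))%N).
  elim=> [|z p IH] y; first by split.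
  have [IH1 IH2] := IH z; split.
    rewrite [uniq _]/= [all _ _]/= => /andP [_ U] /andP [_ Al].
    rewrite /=; case Pz: (P z).
      by have := IH2 z [::] Pz erefl erefl U Al; lia.
    by have := IH1 U Al; lia.
  move=> x q Px Ly Lp U Al /=.
  have U' : uniq (z :: p).
    by move: U; rewrite -cat_cons cat_uniq => /and3P [].
  have Al' : all (leq^~ N) (z :: p).
    by move: Al; rewrite -cat_cons all_cat => /andP [].
  have [hv|lt] := boolP (heavy y z); rewrite /=.
    case Pz: (P z); last by have := IH1 U' Al'; lia.
    by have := IH2 z [::] Pz erefl erefl U' Al'; lia.
  have Lp' : path (fun a b => ~~ heavy a b) x (rcons q z).
    by rewrite rcons_path Lp Ly.
  have [U2 A2] : uniq (x :: rcons q z ++ p) /\ all (leq^~ N) (x :: rcons q z ++ p).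
    by rewrite cat_rcons.
  have [Pz|nPz] := boolP (P z).
    have [Uq Aq] : uniq (x :: rcons q z) /\ all (leq^~ N) (x :: rcons q z).
      move: U2 A2; rewrite -cat_cons cat_uniq all_cat => /and3P [-> _ _].
      by case/andP=> ->.
    by have := H x (rcons q z) Uq Aq Lp'; rewrite last_rcons => /(_ Px Pz); case: (q).
  by have := IH2 x (rcons q z) Px (last_rcons _ _ _) Lp' U2 A2; lia.
move=> x p U Al; have [M1 M2] := main p x; rewrite /=.
case Px: (P x); last by have := M1 U Al; lia.
by have := M2 x [::] Px erefl erefl U Al; lia.
Qed.

(** Distinct points may be at distance 0, as requests can share a leaf. *)
Definition ultrametric (d : nat -> nat -> R) : Prop :=
  [/\ forall x y, 0 <= d x y, forall x y, d x y = d y x, forall x, d x x = 0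
    & forall x y z, d x z <= Rmax (d x y) (d y z)].

Section NearestNeighbour.

Variables (n : nat) (d : nat -> nat -> R) (y c : nat -> R).
Hypothesis ud : ultrametric d.
Hypothesis c_ge0 : forall i, (1 <= i <= n)%N -> 0 <= c i.
Hypothesis c_nn : forall i j, (1 <= i)%N -> (i <= j <= n)%N ->
  c i <= y j - y i.-1 + d j i.-1.

(** Time is charged in both directions; by this symmetry a run can also be read backwards. *)
Definition hop (a b : nat) : R := Rmax (d a b) (Rabs (y a - y b)).

(* The last point leaves no edge; counting it as a source absorbs the [+ 1] of
   [count_isolated]. *)
Definition source (D : R) (a : nat) : bool := (a == n) || rleb D (c a.+1).

Definition heavy_hop (D : R) (a b : nat) : bool := rleb D (4 * hop a b).

Lemma hop_ge0 a b : 0 <= hop a b.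
Proof.
have [h _ _ _] := ud; have := h a b.
by have := Rmax_l (d a b) (Rabs (y a - y b)); rewrite /hop; lra.
Qed.

(* Near a source [x], the points served up to [x] have times at most
   [y x + D / 4], the later ones at least [y x + 3 * D / 4]: no light hop crosses. *)
Lemma light_run_below D x : 0 < D -> (x <= n)%N -> source D x ->
  forall q z, (z <= x)%N -> d z x <= D / 4 -> all (leq^~ n) q ->
  path (fun a b => ~~ heavy_hop D a b) z q -> all (leq^~ x) q.
Proof.
move=> hD xn sx; have [_ dC _ dU] := ud.
elim=> //= w q IH z zx dzx /andP [wn qn] /andP [/rlebP hl lq].
have h1 : d z w <= hop z w by apply: Rmax_l.
have h2 : Rabs (y z - y w) <= hop z w by apply: Rmax_r.
have dwx : d w x <= D / 4.
  have := dU w z x; rewrite (dC w z).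
  by rewrite /Rmax; case: Rle_dec; lra.
case: (leqP w x) => wx; first by apply: (IH w).
have xn' : (x < n)%N by apply: leq_trans wx wn.
(* [x < w] excludes the artificial source at [n]. Then [k1] and [k2] put [y w] at least [D / 2]
   above [y z], too far for a light hop. *)
move: sx; rewrite /source ltn_eqF //= => /rlebP sx.
have k1 : c x.+1 <= y w - y x + d w x by apply: (c_nn (i := x.+1)); lia.
have k2 : y z <= y x + D / 4.
  move: zx; rewrite leq_eqVlt => /orP [/eqP -> |zx]; first lra.
  have := c_nn (i := z.+1) (j := x); have := c_ge0 (i := z.+1).
  by move=> /(_ ltac:(lia)) a1 /(_ ltac:(lia) ltac:(lia)) /=; rewrite (dC x z); lra.
by move: h2; rewrite /Rabs; case: Rcase_abs => h h2; lra.
Qed.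

(** Reading the run from both ends with [light_run_below] gives [last x q <= x] and [x <= last x q];
    a duplicate-free run with equal ends is a single point. *)
Lemma light_run_one_source D x q : 0 < D ->
  uniq (x :: q) -> all (leq^~ n) (x :: q) ->
  path (fun a b => ~~ heavy_hop D a b) x q ->
  source D x -> source D (last x q) -> q = [::].
Proof.
move=> hD U Al lq sx sl; have [d0 dC dxx dU] := ud.
have hvC a b : heavy_hop D a b = heavy_hop D b a.
  by rewrite /heavy_hop /hop dC Rabs_minus_sym.
have hxn : (x <= n)%N by case/andP: Al.
have hln : (last x q <= n)%N by apply: (allP Al); apply: mem_last.
have B1 : all (leq^~ x) q.
  by apply: (light_run_below hD hxn sx (leqnn x)) lq; [rewrite dxx; lra|case/andP: Al].
have B2 : all (leq^~ (last x q)) (rev (belast x q)).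
  apply: (light_run_below hD hln sl (leqnn _)).
  - by rewrite dxx; lra.
  - by rewrite all_rev; apply/allP => z /mem_belast; apply: (allP Al).
  - by rewrite rev_path; under eq_path do rewrite hvC.
case: q U Al lq sl hln B1 B2 => // w q U Al lq sl hln B1 B2.
have : (last w q <= x)%N by apply: (allP B1); apply: mem_last.
have : (x <= last w q)%N by apply: (allP B2); rewrite mem_rev inE eqxx.
move=> h1 h2; have E : x = last w q by lia.
by move: U => /= /andP [/negP []]; rewrite E mem_last.
Qed.

Lemma nn_sum_le p : perm_eq (0%N :: p) (iota 0 n.+1) ->
  Rsum [seq c i | i <- iota 1 n] <= 4 * Rsum (pairmap hop 0%N p).
Proof.
move=> pp.
have scale (s : seq R) : 4 * Rsum s = Rsum [seq 4 * w | w <- s].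
  by elim: s => [|w s IH] /=; [lra|rewrite -IH; lra].
rewrite scale; apply: Rsum_le_counts.
  move=> w; elim: p (0%N) {pp} => //= b p IH a [<-|/IH //].
  by have := hop_ge0 a b; lra.
move=> D hD.
have U : uniq (0%N :: p) by rewrite (perm_uniq pp) iota_uniq.
have Al : all (leq^~ n) (0%N :: p).
  by apply/allP => z; rewrite (perm_mem pp) mem_iota /=; lia.
have := count_isolated (fun x q => @light_run_one_source D x q hD) U Al.
(* The artificial source at [n] is split off and cancels the [.+1]. *)
rewrite (permP pp) -addn1 iotaD count_cat /= [source D (0 + n)]/source eqxx /= addn0.
rewrite addn1 ltnS => H.
have -> : count (rleb D) [seq c i | i <- iota 1 n] = count (fun a => rleb D (c a.+1)) (iota 0 n).
  by rewrite (iotaDl 1 0 n) -map_comp count_map.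
have <- : count (source D) (iota 0 n) = count (fun a => rleb D (c a.+1)) (iota 0 n).
  by apply: eq_in_count => a; rewrite mem_iota /source /= => h; rewrite ltn_eqF.
apply: leq_trans H _; apply: eq_leq.
by elim: p (0%N) {pp U Al} => //= b p IH a; rewrite IH.
Qed.

End NearestNeighbour.

(** * Compressing time *)

Fixpoint psum (f : nat -> R) (k : nat) : R :=
  if k is k'.+1 then psum f k' + f k' else 0.

Lemma psum_le (f g : nat -> R) p q : (p <= q)%N ->
  (forall k, (p <= k < q)%N -> f k <= g k) ->
  psum f q - psum f p <= psum g q - psum g p.
Proof.
elim: q => [|q IH] pq h; first by have -> : p = 0%N by [lia]; lra.
move: pq; rewrite leq_eqVlt => /orP [/eqP -> |pq]; first lra.
have h1 := IH pq (fun k hk => h k ltac:(lia)).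
by have /= := h q ltac:(lia); lra.
Qed.

Lemma psumS (f : nat -> R) k : psum f k.+1 = psum f k + f k.
Proof. by []. Qed.

Lemma psum_telescope (f : nat -> R) k : psum (fun j => f j.+1 - f j) k = f k - f 0%N.
Proof. by elim: k => [|k IH] /=; [|rewrite IH]; lra. Qed.

(* [s] lists the request times along an offline order and [D] its running cost.
   The order passes [gap k] once, upwards, at no cost, so the gaps have to be
   shortened before times can be compared with [D].  A gap keeps at most the
   credit that the cost [D] provides from the left ([fwd]) and from the right
   ([bwd]). *)
Section Compression.

Variables (n : nat) (s D : nat -> R).
Hypothesis D_mono : forall k, (k < n)%N -> D k <= D k.+1.
Hypothesis s_drop : forall k, (k < n)%N -> s k - s k.+1 <= D k.+1 - D k.

Fixpoint pmax k : R := if k is k'.+1 then Rmax (pmax k') (s k) else s 0%N.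

(** Positions are counted from the end, which makes the suffix minimum a structural recursion. *)
Fixpoint smin_rec j : R := if j is j'.+1 then Rmin (s (n - j)%N) (smin_rec j') else s n.

Definition smin k : R := smin_rec (n - k)%N.

(** The stretch of the time axis above all times up to position [k] and below all later ones. *)
Definition gap k : R := Rmax 0 (smin k.+1 - pmax k).

(** [D k - fwd k] is the part of the cost up to position [k] that the gaps before [k] have not
    taken. *)
Fixpoint fwd k : R := if k is k'.+1 then Rmin (D k) (fwd k' + gap k') else D 0%N.

(** Mirror image of [fwd]: [bwd k - D k] is what the gaps from [k] on leave of the cost incurred
    after position [k]. *)
Fixpoint bwd_rec j : R :=
  if j is j'.+1 then Rmax (D (n - j)%N) (bwd_rec j' - gap (n - j)%N) else D n.

Definition bwd k : R := bwd_rec (n - k)%N.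

Definition kept k : R := Rmin (gap k) (fwd k.+1 - fwd k + (bwd k.+1 - bwd k)).

Definition compressed k : R := s k - psum gap k + psum kept k.

Lemma smin_n : smin n = s n.
Proof. by rewrite /smin subnn. Qed.

Lemma sminS k : (k < n)%N -> smin k = Rmin (s k) (smin k.+1).
Proof.
move=> kn; rewrite /smin; have -> : (n - k = (n - k.+1).+1)%N by lia.
by rewrite /=; have -> : (n - (n - k.+1).+1 = k)%N by lia.
Qed.

Lemma bwd_n : bwd n = D n.
Proof. by rewrite /bwd subnn. Qed.

Lemma bwdS k : (k < n)%N -> bwd k = Rmax (D k) (bwd k.+1 - gap k).
Proof.
move=> kn; rewrite /bwd; have -> : (n - k = (n - k.+1).+1)%N by lia.
by rewrite /=; have -> : (n - (n - k.+1).+1 = k)%N by lia.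
Qed.

Ltac minmax := rewrite /Rmax /Rmin; repeat (case: Rle_dec => ?); try lra.

Lemma smin_le k : (k <= n)%N -> smin k <= s k.
Proof.
rewrite leq_eqVlt => /orP [/eqP ->|kn]; first by rewrite smin_n; lra.
by rewrite sminS //; minmax.
Qed.

Lemma smin_mono p q : (p <= q <= n)%N -> smin p <= smin q.
Proof.
elim: q => [|q IH] h; first by have -> : p = 0%N by [lia]; lra.
case: (ltnP q p) => hq; first by have -> : p = q.+1 by [lia]; lra.
by have := IH ltac:(lia); rewrite (@sminS q) ?(@sminS q) //; minmax; lia.
Qed.

Lemma pmax_ge p q : (p <= q)%N -> s p <= pmax q.
Proof.
elim: q => [|q IH]; first by rewrite leqn0 => /eqP -> /=; lra.
rewrite leq_eqVlt => /orP [/eqP -> |/IH] /=; minmax.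
Qed.

Lemma gap_ge0 k : 0 <= gap k.
Proof. by rewrite /gap; minmax. Qed.

(** A gap of positive length would give [s p <= pmax k < smin k.+1 <= s q]. *)
Lemma gap0 p q k : (p <= k < q)%N -> (q <= n)%N -> s q <= s p -> gap k = 0.
Proof.
move=> hk qn hs; have := @pmax_ge p k ltac:(lia).
have := @smin_mono k.+1 q ltac:(lia); have := smin_le qn.
by rewrite /gap; minmax.
Qed.

(** The gaps are disjoint intervals, and those between [p] and [q] lie above [s p] and below
    [smin q]. *)
Lemma gaps_le p q : (p <= q <= n)%N ->
  psum gap q - psum gap p <= Rmax 0 (smin q - s p).
Proof.
elim: q => [|q IH] h.
  by have -> : p = 0%N by [lia]; minmax.
case: (ltnP q p) => hq; first by have -> : p = q.+1 by [lia]; minmax.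
have := IH ltac:(lia); rewrite /=.
have := @pmax_ge p q ltac:(lia); have := @pmax_ge q q (leqnn q).
have := @smin_le q ltac:(lia); have := @smin_mono q q.+1 ltac:(lia).
by rewrite /gap; minmax.
Qed.

Lemma fwd_le k : fwd k <= D k.
Proof. by case: k => [|k] /=; minmax. Qed.

Lemma fwd_step k : (k < n)%N -> 0 <= fwd k.+1 - fwd k <= gap k.
Proof.
by move=> kn; have := fwd_le k; have := D_mono kn; have := gap_ge0 k => /=; minmax.
Qed.

Lemma bwd_ge k : (k <= n)%N -> D k <= bwd k.
Proof.
rewrite leq_eqVlt => /orP [/eqP ->|kn]; first by rewrite bwd_n; lra.
by rewrite bwdS //; minmax.
Qed.

Lemma bwd_step k : (k < n)%N -> 0 <= bwd k.+1 - bwd k <= gap k.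
Proof.
move=> kn; have := bwd_ge kn; have := D_mono kn; have := gap_ge0 k.
by rewrite (bwdS kn); minmax.
Qed.

Lemma kept_bounds k : (k < n)%N -> 0 <= kept k <= gap k.
Proof.
by move=> kn; have := fwd_step kn; have := bwd_step kn; rewrite /kept; minmax.
Qed.

(* If some gap between [p] and [q] is shortened, both the forward and the
   backward credit are exhausted there, so the kept parts already sum up to the
   whole cost incurred between [p] and [q]. *)
Lemma kept_ge p q : (p <= q <= n)%N ->
  psum gap q - psum gap p <= psum kept q - psum kept p \/
  D q - D p <= psum kept q - psum kept p.
Proof.
move=> /andP [pq qn].
have [hs|/hasPn hs] := boolP (has (fun k => ~~ rleb (gap k) (kept k)) (iota p (q - p))).
  right; case/hasP: hs => k; rewrite mem_iota => hk /rlebP hg.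
  have kn : (k < n)%N by lia.
  have e1 : fwd k.+1 = D k.+1 by move: hg (bwd_step kn); rewrite /kept /=; minmax.
  have e2 : bwd k = D k by move: hg (fwd_step kn); rewrite /kept (bwdS kn); minmax.
  have e3 : kept k = fwd k.+1 - fwd k + (bwd k.+1 - bwd k).
    by move: hg; rewrite /kept; minmax.
  (* Gaps before [k] are estimated by their forward credit, later ones by their backward credit, and
     gap [k] by both; the sum telescopes to [D k.+1 - fwd p + bwd q - D k]. *)
  have h1 := @psum_le (fun j => fwd j.+1 - fwd j) kept p k ltac:(lia).
  have h2 := @psum_le (fun j => bwd j.+1 - bwd j) kept k.+1 q ltac:(lia).
  rewrite !psum_telescope in h1 h2.
  have {}h1 : fwd k - fwd p <= psum kept k - psum kept p.
    suff h : forall j, (p <= j < k)%N -> fwd j.+1 - fwd j <= kept j by have := h1 h; lra.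
    move=> j hj; have jn : (j < n)%N by lia.
    by have := fwd_step jn; have := bwd_step jn; rewrite /kept; minmax.
  have {}h2 : bwd q - bwd k.+1 <= psum kept q - psum kept k.+1.
    suff h : forall j, (k.+1 <= j < q)%N -> bwd j.+1 - bwd j <= kept j by have := h2 h; lra.
    move=> j hj; have jn : (j < n)%N by lia.
    by have := fwd_step jn; have := bwd_step jn; rewrite /kept; minmax.
  have := fwd_le p; have := bwd_ge qn; have := D_mono kn.
  move: h2; rewrite /=; lra.
left; apply: psum_le => // k hk.
by have /hs : k \in iota p (q - p) by [rewrite mem_iota; lia]; rewrite negbK => /rlebP.
Qed.

Lemma compressed_back p q : (p <= q <= n)%N -> s q <= s p ->
  compressed p - compressed q = s p - s q.
Proof.
move=> h hs; have g0 k : (p <= k < q)%N -> gap k = 0.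
  by move=> hk; apply: gap0 hk _ hs; lia.
have h1 := @psum_le gap (fun _ => 0) p q ltac:(lia).
have h2 := @psum_le (fun _ => 0) gap p q ltac:(lia).
have h3 := @psum_le kept gap p q ltac:(lia).
have h4 := @psum_le (fun _ => 0) kept p q ltac:(lia).
have {}h1 := h1 (fun k hk => ltac:(rewrite g0 //; lra)).
have {}h2 := h2 (fun k hk => gap_ge0 k).
have {}h3 := h3 (fun k hk => proj2 (@kept_bounds k ltac:(lia))).
have {}h4 := h4 (fun k hk => proj1 (@kept_bounds k ltac:(lia))).
have z k : psum (fun _ => 0) k = 0 by elim: k => //= k ->; lra.
by rewrite /compressed; rewrite !z in h1 h2 h4; lra.
Qed.

(** The gaps in between sum to at most the rise, so it stays nonnegative. By [kept_ge] either
    nothing is lost or the remaining rise covers the cost between the two positions. *)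
Lemma compressed_forth p q : (p <= q <= n)%N -> s p <= s q ->
  0 <= compressed q - compressed p <= s q - s p /\
  (s q - s p <= compressed q - compressed p \/
   D q - D p <= compressed q - compressed p).
Proof.
move=> h hs; have h1 := gaps_le h; have h2 := kept_ge h.
have h3 := @psum_le kept gap p q ltac:(lia) (fun k hk => proj2 (@kept_bounds k ltac:(lia))).
have h4 := @psum_le (fun _ => 0) kept p q ltac:(lia)
  (fun k hk => proj1 (@kept_bounds k ltac:(lia))).
have z k : psum (fun _ => 0) k = 0 by elim: k => //= k ->; lra.
have h5 := @smin_le q ltac:(lia).
rewrite !z in h4; rewrite /compressed; move: h1; minmax.
Qed.

(** A time level between the end points that lies in no gap is crossed downwards as well, and [D]
    pays for downward moves. *)
Lemma gapless_range : s n - psum gap n - s 0%N <= D n - D 0%N.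
Proof.
have m0 : smin 0 <= s 0%N by apply: smin_le.
(* The term [pmax k - s k], the current drop below the running maximum, makes the bound inductive;
   [D] has paid for this drop. *)
suff : forall k, (k <= n)%N ->
    smin k - psum gap k + (pmax k - s k) <= s 0%N + (D k - D 0%N).
  by move=> /(_ n (leqnn n)); rewrite smin_n; have := @pmax_ge n n (leqnn n); lra.
elim=> [|k IH] kn; first by rewrite /=; lra.
have := IH (ltnW kn); have := s_drop kn; have := D_mono kn.
have := @pmax_ge k k (leqnn k); have := smin_le kn.
rewrite (sminS kn) /= /gap; minmax.
Qed.

(** The 5 consists of 1 for the net rise outside the gaps, 2 because an absolute value exceeds the
    signed change by twice the drop, and 1 for each of the two credits. *)
Lemma compressed_variation :
  psum (fun k => Rabs (compressed k.+1 - compressed k)) n <= 5 * (D n - D 0%N).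
Proof.
have step k : (k < n)%N -> Rabs (compressed k.+1 - compressed k) <=
    (s k.+1 - psum gap k.+1 - (s k - psum gap k))
    + 2 * (D k.+1 - D k) + (fwd k.+1 - fwd k + (bwd k.+1 - bwd k)).
  move=> kn; have hk := kept_bounds kn; have hd := s_drop kn; have hm := D_mono kn.
  have f := fwd_step kn; have b := bwd_step kn.
  have hk' : kept k <= fwd k.+1 - fwd k + (bwd k.+1 - bwd k) by rewrite /kept; minmax.
  have g := @gaps_le k k.+1 ltac:(lia); have l := smin_le kn.
  have gz : s k.+1 <= s k -> gap k = 0 by move=> h; apply: (@gap0 k k.+1) h; lia.
  rewrite /compressed !psumS; rewrite !psumS in g; move: g.
  case: (Rle_dec (s k.+1) (s k)) => h.
    by rewrite (gz h); rewrite (gz h) in hk; rewrite /Rabs; case: Rcase_abs; lra.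
  by rewrite /Rabs; minmax; case: Rcase_abs; lra.
have h := @psum_le _ _ 0%N n (leq0n n) (fun k hk => step k ltac:(lia)).
pose A k := s k - psum gap k; pose B k := 2 * D k + fwd k + bwd k.
have E : psum (fun k => (s k.+1 - psum gap k.+1 - (s k - psum gap k))
    + 2 * (D k.+1 - D k) + (fwd k.+1 - fwd k + (bwd k.+1 - bwd k))) n
    = (A n - A 0%N) + (B n - B 0%N).
  rewrite -[A n - _]psum_telescope -[B n - _]psum_telescope /A /B.
  by elim: (n) => [|k IH] /=; [|rewrite IH /=]; lra.
rewrite E in h; move: h (gapless_range) (fwd_le n) (@bwd_ge 0%N isT).
by rewrite /A /B bwd_n /=; lra.
Qed.

End Compression.

Lemma psumSl (f : nat -> R) k : psum f k.+1 = f 0%N + psum (fun j => f j.+1) k.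
Proof. by elim: k => [|k IH] /=; [|move: IH => /= ->]; lra. Qed.

Lemma Rsum_pairmap (f : nat -> nat -> R) x p :
  Rsum (pairmap f x p) =
  psum (fun k => f (nth 0%N (x :: p) k) (nth 0%N (x :: p) k.+1)) (size p).
Proof. by elim: p x => // z p IH x; rewrite [size _]/= psumSl /= IH. Qed.

Lemma Rsum_iota (f : nat -> R) n : Rsum [seq f i | i <- iota 1 n] = psum (fun k => f k.+1) n.
Proof.
elim: n => // n IH; rewrite -{1}(addn1 n) iotaD map_cat Rsum_cat IH /= add1n; lra.
Qed.

Lemma psum_add (f g : nat -> R) k : psum (fun j => f j + g j) k = psum f k + psum g k.
Proof. by elim: k => [|k IH] /=; [|rewrite IH]; lra. Qed.

(** Points are numbered in queue order and [p] is the offline order. In compressed time the hops of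
    [p] sum to at most [1 + 5] times its cost, and [nn_sum_le] contributes a factor 4; the constant
    29 leaves room above 24. *)
Lemma nn_competitive n (d : nat -> nat -> R) (t ts : nat -> R) p :
  ultrametric d ->
  perm_eq (0%N :: p) (iota 0 n.+1) ->
  (forall i, (i <= n)%N -> t 0%N <= t i) ->
  (forall i, (1 <= i <= n)%N -> t i <= ts i /\ t i.-1 <= ts i) ->
  (forall i j, (1 <= i)%N -> (i <= j <= n)%N -> ts i <= t j + d j i.-1) ->
  Rsum [seq ts i - t i | i <- iota 1 n]
    <= 29 * Rsum (pairmap (fun a b => Rmax (d a b) (t a - t b)) 0%N p).
Proof.
move=> ud pp t0 tge tnn; have [d0 dC dxx dU] := ud.
set w := 0%N :: p in pp *.
have szw : size w = n.+1 by rewrite (perm_size pp) size_iota.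
have szp : size p = n by move: szw => /= [].
have U : uniq w by rewrite (perm_uniq pp) iota_uniq.
have mw k : (k \in w) = (k <= n)%N by rewrite (perm_mem pp) mem_iota.
pose cost a b := Rmax (d a b) (t a - t b).
pose s q := t (nth 0%N w q).
pose D q := psum (fun k => cost (nth 0%N w k) (nth 0%N w k.+1)) q.
have ED : Rsum (pairmap cost 0%N p) = D n by rewrite Rsum_pairmap szp.
rewrite -/cost ED.
have DS k : D k.+1 = D k + cost (nth 0%N w k) (nth 0%N w k.+1) by [].
have Dm k : (k < n)%N -> D k <= D k.+1.
  move=> _; have := d0 (nth 0%N w k) (nth 0%N w k.+1); rewrite DS /cost.
  by have := Rmax_l (d (nth 0%N w k) (nth 0%N w k.+1)) (t (nth 0%N w k) - t (nth 0%N w k.+1)); lra.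
have sd k : (k < n)%N -> s k - s k.+1 <= D k.+1 - D k.
  move=> _; rewrite DS /cost /s.
  by have := Rmax_r (d (nth 0%N w k) (nth 0%N w k.+1)) (t (nth 0%N w k) - t (nth 0%N w k.+1)); lra.
have dD a b : (a <= b <= n)%N -> d (nth 0%N w a) (nth 0%N w b) <= D b - D a.
  elim: b => [|b IH] h; first by have -> : a = 0%N by [lia]; rewrite dxx; lra.
  case: (ltnP b a) => hb; first by have -> : a = b.+1 by [lia]; rewrite dxx; lra.
  have := IH ltac:(lia); have := dU (nth 0%N w a) (nth 0%N w b) (nth 0%N w b.+1).
  have := d0 (nth 0%N w a) (nth 0%N w b); have := d0 (nth 0%N w b) (nth 0%N w b.+1).
  rewrite DS /cost.
  have := Rmax_l (d (nth 0%N w b) (nth 0%N w b.+1)) (t (nth 0%N w b) - t (nth 0%N w b.+1)).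
  by rewrite {2}/Rmax; case: Rle_dec; lra.
pose C := compressed n s D.
pose y k := C (index k w).
have pos k : (k <= n)%N -> (index k w <= n)%N /\ nth 0%N w (index k w) = k.
  by move=> kn; rewrite -mw in kn; rewrite nth_index // -ltnS -szw index_mem.
(* Compressed time is monotone and 1-Lipschitz in time, and a difference that got shortened still
   covers the distance. *)
have ylip i j : (i <= n)%N -> (j <= n)%N -> t i <= t j ->
    0 <= y j - y i <= t j - t i /\ (t j - t i <= y j - y i \/ d i j <= y j - y i).
  move=> hi hj hij; have [pi ei] := pos i hi; have [pj ej] := pos j hj.
  have si : s (index i w) = t i by rewrite /s ei.
  have sj : s (index j w) = t j by rewrite /s ej.
  case: (leqP (index i w) (index j w)) => hp.
    have hpj : (index i w <= index j w <= n)%N by rewrite hp.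
    have := compressed_forth (s := s) Dm hpj; have := dD _ _ hpj.
    by rewrite si sj ei ej -/C -/(y i) -/(y j) => h1 /(_ hij) [h2 h3]; split; lra.
  have hpj : (index j w <= index i w <= n)%N by rewrite (ltnW hp).
  have := compressed_back (s := s) Dm hpj; rewrite si sj -/C -/(y i) -/(y j) => /(_ hij).
  by move=> h; split; [|left]; lra.
(* The latency is left as it is; only the time between consecutive requests is compressed. *)
pose c i := ts i - t i + (y i - y i.-1).
have cge0 i : (1 <= i <= n)%N -> 0 <= c i.
  move=> hi; have [h1 h2] := tge i hi; rewrite /c.
  case: (Rle_dec (t i.-1) (t i)) => h.
    by have [] := ylip i.-1 i ltac:(lia) ltac:(lia) h; lra.
  by have [] := ylip i i.-1 ltac:(lia) ltac:(lia) ltac:(lra); lra.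
have cnn i j : (1 <= i)%N -> (i <= j <= n)%N -> c i <= y j - y i.-1 + d j i.-1.
  move=> hi hj; have h := tnn i j hi hj; rewrite /c.
  case: (Rle_dec (t j) (t i)) => hij.
    by have [] := ylip j i ltac:(lia) ltac:(lia) hij; lra.
  have [_ [] h2] := ylip i j ltac:(lia) ltac:(lia) ltac:(lra); first lra.
  (* Here [y j - y i] covers [d i j], so the bound for [ts i] from [i] itself and the triangle
     inequality suffice. *)
  have := tnn i i hi ltac:(lia); have := dU i j i.-1.
  have := d0 i j; have := d0 j i.-1.
  by rewrite /Rmax; case: Rle_dec; lra.
have main := nn_sum_le ud cge0 cnn pp.
have Ec : Rsum [seq c i | i <- iota 1 n] = Rsum [seq ts i - t i | i <- iota 1 n] + (y n - y 0%N).
  by rewrite !Rsum_iota -(psum_telescope y) -psum_add.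
have var : psum (fun k => Rabs (C k.+1 - C k)) n <= 5 * (D n - D 0%N).
  exact: compressed_variation Dm sd.
have hops : Rsum (pairmap (hop d y) 0%N p) <= D n + 5 * (D n - D 0%N).
  rewrite Rsum_pairmap szp -/w.
  pose f k := hop d y (nth 0%N w k) (nth 0%N w k.+1).
  pose g k := cost (nth 0%N w k) (nth 0%N w k.+1) + Rabs (C k.+1 - C k).
  change (psum f n <= D n + 5 * (D n - D 0%N)).
  have Eg : psum g n = D n + psum (fun k => Rabs (C k.+1 - C k)) n by rewrite psum_add.
  suff h : forall k, (0 <= k < n)%N -> f k <= g k.
    have := psum_le (leq0n n) h; rewrite Eg [psum f 0]/= [psum g 0]/=; lra.
  move=> k hk; have kn : (k < n)%N by lia.
  rewrite /f /g /hop /cost /y !index_uniq ?szw //; try lia.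
  rewrite (Rabs_minus_sym (C k.+1)).
  have := d0 (nth 0%N w k) (nth 0%N w k.+1); have := Rabs_pos (C k - C k.+1).
  have := Rmax_l (d (nth 0%N w k) (nth 0%N w k.+1)) (t (nth 0%N w k) - t (nth 0%N w k.+1)).
  by rewrite {2}/Rmax; case: Rle_dec; lra.
have yn : y 0%N <= y n.
  by have [] := ylip 0%N n (leq0n n) (leqnn n) (t0 n (leqnn n)); lra.
have Dn : D 0%N = 0 by [].
have Dpos : 0 <= D n by have := dD 0%N n ltac:(lia); have := d0 (nth 0%N w 0) (nth 0%N w n); lra.
rewrite Dn in hops; lra.
Qed.

(** * Tree geometry *)

Notation node := (seq nat).

Definition par (x : node) : node := take (size x).-1 x.

(** [par] fixes the root; the tests against [[::]] keep the root from being its own neighbour. *)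
Definition adj (x y : node) : bool :=
  ((x != [::]) && (y == par x)) || ((y != [::]) && (x == par y)).

(* Every edge joins a node to its parent, so it is determined by its lower end. *)
Definition child_end (x y : node) : node := if (size x < size y)%N then y else x.

(** For adjacent [p] and [q], the component of [p] once their edge is deleted: the subtree of the
    lower end or its complement. *)
Definition side (p q x : node) : bool :=
  prefix (child_end p q) x == prefix (child_end p q) p.

Lemma par_rcons x a : par (rcons x a) = x.
Proof. by rewrite /par size_rcons /= -cats1 take_size_cat. Qed.

Lemma adjC x y : adj x y = adj y x.
Proof. by rewrite /adj orbC. Qed.

Lemma adjP x y : adj x y ->
  (exists a, x = rcons y a /\ child_end x y = x /\ child_end y x = x) \/
  (exists a, y = rcons x a /\ child_end x y = y /\ child_end y x = y).
Proof.
have main u v : u != [::] -> v = par u -> exists a, u = rcons v a.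
  by case/lastP: u => // u a _ ->; exists a; rewrite par_rcons.
case/orP => /andP [nz /eqP E]; [left|right]; have [a Ea] := main _ _ nz E; exists a;
  by rewrite /child_end Ea size_rcons ltnSn ltnNge leqnSn.
Qed.

Lemma prefix_rcons_neq (c x : node) a : c != rcons x a -> prefix c (rcons x a) = prefix c x.
Proof.
move=> nE; apply/idP/idP => [|/prefix_trans]; last by apply; apply: prefix_rcons.
case/prefixP => l; case/lastP: l => [|l b]; first by rewrite cats0 => E; rewrite E eqxx in nE.
by rewrite -rcons_cat => /rcons_inj [-> _]; apply: prefix_prefix.
Qed.

Lemma prefix_rconsN (x : node) a : prefix (rcons x a) x = false.
Proof. by apply/negP => /size_prefix; rewrite size_rcons ltnn. Qed.

Lemma side_self p q : side p q p.
Proof. by rewrite /side. Qed.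

Lemma sideN p q x : adj p q -> side q p x = ~~ side p q x.
Proof.
case/adjP => [[a [-> [E1 E2]]]|[a [-> [E1 E2]]]]; rewrite /side E1 E2 prefix_refl prefix_rconsN;
  by case: prefix.
Qed.

Lemma side_other p q : adj p q -> side p q q = false.
Proof. by move=> h; rewrite -[side _ _ _]negbK -sideN // side_self. Qed.

Lemma adj_neq p q : adj p q -> p != q.
Proof. by move=> h; apply/eqP => E; have := side_other h; rewrite -E side_self. Qed.

Lemma side_step p q x x' : adj p q -> adj x x' -> side p q x -> ~~ side p q x' ->
  x = p /\ x' = q.
Proof.
move=> hp hx; rewrite /side => /eqP h1 h2.
have {h2} : prefix (child_end p q) x != prefix (child_end p q) x'.
  by rewrite h1 eq_sym.
case/adjP: hx h1 => [[a [-> _]]|[a [-> _]]] h1 h2.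
  have E : child_end p q = rcons x' a.
    by apply/eqP; apply/negPn/negP => nE; rewrite prefix_rcons_neq ?eqxx in h2.
  case/adjP: hp => [[b [Ep [E1 _]]]|[b [Eq [E1 _]]]].
    by move: E; rewrite E1 Ep => /rcons_inj [-> ->].
  by move: h1; rewrite E1 Eq prefix_rconsN -Eq -E1 E prefix_refl.
have E : child_end p q = rcons x a.
  by apply/eqP; apply/negPn/negP => nE; rewrite prefix_rcons_neq ?eqxx in h2.
case/adjP: hp => [[b [Ep [E1 _]]]|[b [Eq [E1 _]]]].
  by move: h1; rewrite E prefix_rconsN -E E1 prefix_refl.
by move: E; rewrite E1 Eq => /rcons_inj [-> ->].
Qed.

Lemma side_adj_eq p q x x' : adj p q -> adj x x' -> (x, x') != (p, q) -> (x, x') != (q, p) ->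
  side p q x = side p q x'.
Proof.
move=> hp hx n1 n2; apply/idP/idP => h; apply/negPn/negP => h'.
  by have [E1 E2] := side_step hp hx h h'; rewrite E1 E2 eqxx in n1.
by move: hx; rewrite adjC => hx; have [E1 E2] := side_step hp hx h h'; rewrite E1 E2 eqxx in n2.
Qed.

Lemma prefix_comparable (c c' x : node) : prefix c x -> prefix c' x -> prefix c c' || prefix c' c.
Proof.
rewrite !prefixE => /eqP E /eqP E'.
have [h|/ltnW h] := leqP (size c) (size c'); apply/orP; [left|right]; apply/eqP.
  by rewrite -[in RHS]E -E' take_takel.
by rewrite -[in RHS]E' -E take_takel.
Qed.

(** The edge between [p] and [q] lies on the path from [x] to [y], and this path stays on one side
    of the edge between [u] and [w]. *)
Lemma side_convex u w p q x y : adj u w -> adj p q ->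
  side u w x -> side u w y -> side p q x -> ~~ side p q y -> side u w p /\ side u w q.
Proof.
move=> huw hpq; rewrite /side; set c1 := child_end u w; set c2 := child_end p q.
set b := prefix c1 u => /eqP bx /eqP byy hx hy.
have sep : prefix c2 x != prefix c2 y by rewrite (eqP hx) eq_sym.
suff [k1 k2] : prefix c1 p = b /\ prefix c1 q = b by rewrite k1 k2 eqxx.
have {hx hy} [z [z' [bz [bz' [hz hz']]]]] : exists z z', prefix c1 z = b /\ prefix c1 z' = b /\
    prefix c2 z /\ ~~ prefix c2 z'.
  case E: (prefix c2 x) sep => /= sep; first by exists x, y; do !split => //; case: prefix sep.
  by exists y, x; rewrite E; do !split => //; case: prefix sep.
suff H v a : c2 = rcons v a -> prefix c1 v = b /\ prefix c1 (rcons v a) = b.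
  case/adjP: (hpq) => [[a [Ep [E2 _]]]|[a [Eq [E2 _]]]].
    by have := H q a; rewrite /c2 E2 -Ep => /(_ erefl) [].
  by have := H p a; rewrite /c2 E2 -Eq => /(_ erefl) [].
move=> E; rewrite -E.
(* If the common side is the subtree of [c1], then [z'] makes [c1] a proper ancestor of [c2];
   otherwise [z] keeps [c1] from being an ancestor of [c2]. *)
case eb: b bz bz' => bz bz'.
  have n12 : ~~ prefix c2 c1 by apply: contra hz' => /prefix_trans; apply.
  have := prefix_comparable bz hz; rewrite (negbTE n12) orbF => h12; split => //.
  rewrite -(@prefix_rcons_neq _ _ a) -E //.
  by apply: contraNneq n12 => ->; apply: prefix_refl.
have h : prefix c1 c2 = false by apply/negP => /prefix_trans /(_ hz); rewrite bz.
split => //; apply/negP => /prefix_trans h'; move: h; rewrite E h' //.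
exact: prefix_rcons.
Qed.

Lemma side_trans w z u v : adj w z -> adj w u -> z != u -> side z w v -> side w u v.
Proof.
move=> wz wu zu szv; apply/negPn/negP => nv.
have swz : side w u z.
  apply/negPn/negP => h; have [_ E] := side_step wu wz (side_self _ _) h.
  by rewrite E eqxx in zu.
have zw : adj z w by rewrite adjC.
by have [] := side_convex zw wu (side_self _ _) szv swz nv; rewrite side_other.
Qed.

(** The number of edges between [x] and [y], a measure for induction along the path. *)
Definition hops (x y : node) : nat := (size x + size y - (lcp x y + lcp x y))%N.

Lemma leq_lcp k (x y : node) :
  (k <= lcp x y)%N = [&& k <= size x, k <= size y & take k x == take k y]%N.
Proof.
elim: x y k => [|a x IH] [|b y] [|k] //=.
- by rewrite andbF.
have [-> |ne] := eqVneq a b; first by rewrite !ltnS IH eqseq_cons eqxx.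
by rewrite eqseq_cons (negbTE ne) /= !andbF.
Qed.

Lemma lcpC x y : lcp x y = lcp y x.
Proof.
by elim: x y => [|a x IH] [|b y] //=; rewrite eq_sym IH.
Qed.

Lemma lcp_le x y : (lcp x y <= size x)%N /\ (lcp x y <= size y)%N.
Proof. by have := leq_lcp (lcp x y) x y; rewrite leqnn => /esym /and3P []. Qed.

Lemma lcp_take x y : take (lcp x y) x = take (lcp x y) y.
Proof. by have := leq_lcp (lcp x y) x y; rewrite leqnn => /esym /and3P [_ _ /eqP]. Qed.

Lemma lcp_prefix c x : prefix c x -> lcp x c = size c.
Proof.
move=> h; apply/eqP; rewrite eqn_leq (proj2 (lcp_le _ _)) leq_lcp leqnn size_prefix //=.
by move: h; rewrite prefixE take_size.
Qed.

Lemma prefix_lcp c x : prefix c x = (size c <= lcp x c)%N.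
Proof.
apply/idP/idP => [/lcp_prefix -> //|]; rewrite leq_lcp prefixE => /and3P [_ _].
by rewrite take_size.
Qed.

Lemma lcp_rconsN c a x : ~~ prefix (rcons c a) x -> lcp x (rcons c a) = lcp x c.
Proof.
rewrite prefix_lcp -ltnNge size_rcons ltnS => h.
have tk k : (k <= size c)%N -> take k (rcons c a) = take k c.
  by move=> hk; rewrite -cats1 takel_cat.
apply/eqP; rewrite eqn_leq; apply/andP; split.
  have := leqnn (lcp x (rcons c a)); rewrite leq_lcp => /and3P [h1 _ h3].
  by rewrite leq_lcp h1 h /= -tk.
have := leqnn (lcp x c); rewrite leq_lcp => /and3P [h1 h2 h3].
by rewrite leq_lcp h1 size_rcons (leq_trans h2) //= tk.
Qed.

Lemma neighbour_toward x y : x != y ->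
  exists z, [/\ adj z y, side z y x & (hops x z < hops x y)%N].
Proof.
move=> ne; have [l1 l2] := lcp_le x y.
have [hp|np] := boolP (prefix y x).
  case/prefixP: (hp) ne => [] [|a l] E; first by rewrite E cats0 eqxx.
  move=> _; exists (rcons y a).
  have pz : prefix (rcons y a) x by rewrite E -cat_rcons prefix_prefix.
  have Ad : adj (rcons y a) y.
    apply/orP; left; apply/andP; split; first by case: (y).
    by rewrite par_rcons.
  split => //.
    rewrite /side /child_end size_rcons ltnNge leqnSn /= prefix_refl pz.
    by [].
  rewrite /hops (lcp_prefix hp) (lcp_prefix pz) size_rcons.
  have hs : (size y < size x)%N by have := size_prefix pz; rewrite size_rcons.
  have key i j : (i < j -> j + i.+1 - (i.+1 + i.+1) < j + i - (i + i))%N by lia.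
  exact: key.
case/lastP: y ne np l1 l2 => [|y a] ne np l1 l2; first by rewrite prefix0s in np.
have Ad : adj y (rcons y a).
  apply/orP; right; apply/andP; split; first by case: (y).
  by rewrite par_rcons.
exists y; split => //.
  by rewrite /side /child_end size_rcons ltnSn prefix_rconsN (negbTE np).
rewrite /hops (lcp_rconsN np) size_rcons.
have [l3 l4] := lcp_le x y; lia.
Qed.

(** [P] has to change on some edge of the path from [x] to [y]. Paths are not represented: the two
    [side] conditions say that the edge lies on this one. *)
Lemma path_boundary (P : pred node) x y : P x -> ~~ P y ->
  exists p q, [/\ adj p q, P p, ~~ P q, side p q x & side q p y].
Proof.
move=> Px; have [k] := ubnP (hops x y); elim: k y => // k IH y hk nPy.
have ne : x != y by apply: contraNneq nPy => <-.
have [z [zy szx hz]] := neighbour_toward ne.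
have [Pz|nPz] := boolP (P z).
  by exists z, y; split => //; apply: side_self.
have [p [q [pq Pp nPq spx sqz]]] := IH z ltac:(lia) nPz.
exists p, q; split => //; apply/negPn/negP => nqy.
have qp : adj q p by rewrite adjC.
by have [_ E] := side_step qp zy sqz nqy; rewrite E Pp in nPy.
Qed.

(** * Weighted tree distance *)

Section Distance.

Variable h : nat.

Definition depth_sum (a b : nat) : nat := \sum_(a <= k < b) edge_len h k.

Lemma depth_sum_split a b c : (a <= b <= c)%N -> depth_sum a c = (depth_sum a b + depth_sum b c)%N.
Proof. by move=> /andP [ab bc]; rewrite /depth_sum (big_cat_nat ab bc). Qed.

Lemma depth_sum_le a a' b b' : (a' <= a)%N -> (b <= b')%N -> (depth_sum a b <= depth_sum a' b')%N.
Proof.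
move=> ha hb; have [hab|hab] := leqP a b; last by rewrite {1}/depth_sum big_geq // ltnW.
rewrite (@depth_sum_split a' a b'); last lia.
by rewrite (@depth_sum_split a b b'); last lia; lia.
Qed.

Lemma dTE u v : dT h u v = INR (depth_sum (lcp u v) (size u) + depth_sum (lcp u v) (size v)).
Proof. by []. Qed.

Lemma dT_ge0 u v : 0 <= dT h u v.
Proof. exact: pos_INR. Qed.

Lemma dT_sym u v : dT h u v = dT h v u.
Proof. by rewrite !dTE lcpC addnC. Qed.

Lemma dT_self u : dT h u u = 0.
Proof. by rewrite dTE (lcp_prefix (prefix_refl u)) /depth_sum !big_geq. Qed.

Lemma dT_step p q x : adj p q -> side p q x -> dT h x q = dT h x p + dT h p q.
Proof.
have one (v : node) a : depth_sum (size v) (size (rcons v a)) = edge_len h (size v).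
  by rewrite /depth_sum size_rcons big_nat1.
have e0 k : depth_sum k k = 0%N by rewrite /depth_sum big_geq.
case/adjP => [[a [-> [E _]]]|[a [-> [E _]]]]; rewrite /side E ?prefix_refl ?prefix_rconsN.
  move/eqP => hx; have hq : prefix q x := prefix_trans (prefix_rcons _ _) hx.
  rewrite !dTE (lcp_prefix hx) (lcp_prefix hq) (lcp_prefix (prefix_rcons q a)) !e0 one !addn0.
  rewrite (@depth_sum_split (size q) (size (rcons q a)) (size x)).
    by rewrite one -plus_INR plusE; congr INR; rewrite addnC.
  by rewrite (size_prefix hx) andbT size_rcons leqnSn.
rewrite eqbF_neg => hx; rewrite !dTE (lcp_rconsN hx).
rewrite [lcp p _]lcpC (lcp_prefix (prefix_rcons p a)) e0 one add0n -plus_INR plusE.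
rewrite (@depth_sum_split (lcp x p) (size p) (size (rcons p a))) ?one ?addnA //.
by rewrite (proj2 (lcp_le _ _)) size_rcons leqnSn.
Qed.

Lemma dT_cut p q x y : adj p q -> side p q x -> side q p y -> dT h x q <= dT h x y.
Proof.
move=> hpq sx; rewrite sideN // => sy.
rewrite !dTE; apply: le_INR; apply/leP.
case/adjP: hpq sx sy => [[a [-> [E _]]]|[a [-> [E _]]]];
  rewrite /side E ?prefix_refl ?prefix_rconsN.
  move/eqP => hx hy; have hq : prefix q x := prefix_trans (prefix_rcons _ _) hx.
  have hl : (lcp x y <= size q)%N.
    rewrite leqNgt; apply/negP; rewrite leq_lcp => /and3P [h1 h2 /eqP h3].
    move: hx hy; rewrite !prefixE size_rcons -h3 => /eqP ->; by rewrite eqxx.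
  rewrite (lcp_prefix hq); apply: leq_add; first exact: depth_sum_le.
  by rewrite {1}/depth_sum big_geq.
rewrite eqbF_neg => hx; rewrite eqbF_neg negbK => hy.
have El : lcp x y = lcp x p.
  rewrite -(lcp_rconsN hx); apply/eqP; rewrite eqn_leq; apply/andP; split.
    have := leqnn (lcp x y); rewrite leq_lcp => /and3P [h1 h2 /eqP h3].
    have hl : (lcp x y <= size (rcons p a))%N.
      rewrite leqNgt; apply: contra hx => hl; rewrite prefixE.
      move: hy; rewrite !prefixE => /eqP {2}<-; apply/eqP.
      have := congr1 (take (size (rcons p a))) h3; rewrite !take_takel //; exact: ltnW.
    rewrite leq_lcp h1 hl /= h3; move: hy; rewrite prefixE => /eqP <-.
    by rewrite take_takel.
  have := leqnn (lcp x (rcons p a)); rewrite leq_lcp => /and3P [h1 h2 /eqP h3].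
  rewrite leq_lcp h1 (leq_trans h2 (size_prefix hy)) h3 /=.
  move: hy; rewrite prefixE => /eqP hy; rewrite -[X in take _ X == _]hy.
  by rewrite take_takel.
rewrite (lcp_rconsN hx) El; apply: leq_add => //; apply: depth_sum_le => //.
exact: size_prefix.
Qed.

(** At equal depth the distance decreases with the length of the common prefix, and the shorter of
    the two prefixes shared with [y] is common to [x] and [z]. *)
Lemma dT_ultra x y z : size x = h -> size y = h -> size z = h ->
  dT h x z <= Rmax (dT h x y) (dT h y z).
Proof.
move=> hx hy hz; rewrite !dTE hx hy hz.
have : (lcp x y <= lcp x z)%N || (lcp y z <= lcp x z)%N.
  have [b1 _] := lcp_le x y; have b3 := lcp_take x y.
  have [a1 a2] := lcp_le y z; have a3 := lcp_take y z.
  rewrite !leq_lcp; rewrite hx in b1; rewrite hy in a1; rewrite hz in a2; rewrite hx hz.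
  rewrite a1 b1 /=; have [c|/ltnW c] := leqP (lcp x y) (lcp y z).
    rewrite b3; have := congr1 (take (lcp x y)) a3; rewrite !take_takel // => ->.
    by rewrite eqxx.
  rewrite -a3; have := congr1 (take (lcp y z)) b3; rewrite !take_takel // => ->.
  by rewrite eqxx orbT.
case/orP => hl.
  apply: Rle_trans (Rmax_l _ _); apply: le_INR; apply/leP.
  by apply: leq_add; apply: depth_sum_le.
apply: Rle_trans (Rmax_r _ _); apply: le_INR; apply/leP.
by apply: leq_add; apply: depth_sum_le.
Qed.

End Distance.

(** * Queues determined at the nodes *)

(** This is all of [l] when [e] does not occur. *)
Definition before (e : nat) (l : seq nat) : seq nat := take (index e l) l.

Lemma before_cat e l1 l2 :
  before e (l1 ++ l2) = if e \in l1 then before e l1 else l1 ++ before e l2.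
Proof.
rewrite /before index_cat; case: ifP => h; first by rewrite takel_cat // index_size.
by rewrite takeD take_size_cat // drop_size_cat.
Qed.

Lemma before_cons e a l : before e (a :: l) = if a == e then [::] else a :: before e l.
Proof. by rewrite /before /=; case: ifP. Qed.

Lemma before_split e l : e \in l -> exists r, l = before e l ++ e :: r.
Proof.
move=> h; exists (drop (index e l).+1 l).
by rewrite -{2}(nth_index 0%N h) -drop_nth ?index_mem // cat_take_drop.
Qed.

Lemma mem_before e l x : x \in before e l -> x \in l.
Proof. exact: mem_take. Qed.

Definition convex (N : pred node) : Prop := forall p q x y, adj p q ->
  N x -> N y -> side p q x -> side q p y -> N p /\ N q.

(* [Q x] is the part of the final queue that is already determined as seen from
   the node [x]; the lists of different nodes may only disagree on their tails. *)
Record coherent (Q : node -> seq nat) : Prop := Coherent {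
  coh_uniq : forall x, uniq (Q x);
  coh_head : forall x, exists l, Q x = 0%N :: l;
  coh_before : forall x y e, e \in Q x -> e \in Q y -> before e (Q x) = before e (Q y);
  coh_conv : forall e, convex (fun x => e \in Q x)
}.

(** Coherent lists agree up to any common entry. So a prefix relation amounts to knowing a single
    entry, and it inherits the convexity of that knowledge. *)
Lemma coh_prefix_last Q u x : coherent Q -> prefix (Q u) (Q x) = (last 0%N (Q u) \in Q x).
Proof.
move=> cQ; have [l El] := coh_head cQ u.
have lu : last 0%N (Q u) \in Q u by rewrite El /= mem_last.
apply/idP/idP => [/prefixP [r ->]|h]; first by rewrite mem_cat lu.
have E := coh_before cQ lu h; have [r Er] := before_split h.
rewrite Er -E -cat_rcons.
suff EQ : Q u = rcons (before (last 0%N (Q u)) (Q u)) (last 0%N (Q u)).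
  by rewrite [X in prefix X _]EQ; apply: prefix_prefix.
have [r' Er'] := before_split lu.
suff E0 : r' = [::] by rewrite -cats1 -E0.
case/lastP: r' Er' => // r' b Er'; have := coh_uniq cQ u.
rewrite {1}Er' -rcons_cons -rcons_cat rcons_uniq.
have -> : b = last 0%N (Q u) by rewrite Er' -rcons_cons -rcons_cat last_rcons.
by rewrite mem_cat inE eqxx orbT.
Qed.

Definition graft (Q : node -> seq nat) (u : node) (T : seq nat) (A : pred node) :=
  fun x : node => if A x then Q u ++ T ++ drop (size (Q u)) (Q x) else Q x.

Lemma graft_split (Q : node -> seq nat) u T (A : pred node) x :
  (forall z, A z -> prefix (Q u) (Q z)) -> A x ->
  exists D, Q x = Q u ++ D /\ graft Q u T A x = Q u ++ T ++ D.
Proof.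
move=> hp Ax; have /prefixP [D E] := hp x Ax; exists D; split => //.
by rewrite /graft Ax E drop_size_cat.
Qed.

Lemma mem_graft (Q : node -> seq nat) u T (A : pred node) x e :
  (forall z, A z -> prefix (Q u) (Q z)) ->
  (e \in graft Q u T A x) = (e \in Q x) || (A x && (e \in T)).
Proof.
move=> hp; case Ax: (A x); last by rewrite /graft Ax orbF.
have [D [E1 E2]] := graft_split T hp Ax.
by rewrite E2 E1 !mem_cat /=; do 3![case: (_ \in _)].
Qed.

(** Conflicts can only arise between [A] and its complement. There no entry behind the insertion
    point is shared, and [T], where already known, stands right behind [Q u]. *)
Lemma graft_coherent Q u T (A : pred node) :
  coherent Q ->
  (forall x, A x -> prefix (Q u) (Q x)) ->
  uniq (Q u ++ T) ->
  (forall x e, A x -> e \in T -> e \notin Q x) ->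
  (forall x e, e \in T -> e \in Q x -> before e (Q x) = before e (Q u ++ T)) ->
  (forall x y e, A x -> ~~ A y -> e \in Q x -> e \in Q y -> e \in Q u) ->
  (forall e, e \in T -> convex (fun x => (e \in Q x) || A x)) ->
  coherent (graft Q u T A).
Proof.
move=> cQ hp uT dT preT closed convT.
have spl := fun x Ax => @graft_split Q u T A x hp Ax.
split.
- move=> x; case Ax: (A x); last by rewrite /graft Ax; apply: coh_uniq.
  have [D [E1 ->]] := spl x Ax; have := coh_uniq cQ x; rewrite E1.
  rewrite !cat_uniq => /and3P [h1 h2 h3]; move: uT; rewrite cat_uniq => /and3P [_ k2 k3].
  rewrite h1 has_cat negb_or k2 h2 k3 h3 /= andbT.
  apply/hasPn => e eD; apply/negP => eT; have := dT x e Ax eT.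
  by rewrite E1 mem_cat eD orbT.
- move=> x; case Ax: (A x); last by rewrite /graft Ax; apply: coh_head.
  have [D [_ ->]] := spl x Ax; have [l ->] := coh_head cQ u; by exists (l ++ T ++ D).
- have mixed x y e : A x -> ~~ A y -> e \in graft Q u T A x -> e \in Q y ->
      before e (graft Q u T A x) = before e (Q y).
    move=> Ax nAy; have [D [E1 E2]] := spl x Ax; rewrite E2 => he ey.
    have [eu|neu] := boolP (e \in Q u).
      by rewrite before_cat eu; apply: coh_before.
    have [eT|neT] := boolP (e \in T).
      by rewrite (preT y e eT ey) catA [LHS]before_cat mem_cat eT orbT.
    move: he; rewrite !mem_cat (negbTE neu) (negbTE neT) /= => eD.
    have ex : e \in Q x by rewrite E1 mem_cat eD orbT.
    by have := closed x y e Ax nAy ex ey; rewrite (negbTE neu).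
  move=> x y e; case Ax: (A x); case Ay: (A y).
  + have [D [E1 E2]] := spl x Ax; have [D' [E1' E2']] := spl y Ay.
    rewrite E2 E2' => he he'; rewrite !before_cat.
    case: ifP => // neu; case: ifP => // neT; congr (_ ++ _); congr (_ ++ _).
    move: he he'; rewrite !mem_cat neu neT /= => eD eD'.
    have := @coh_before _ cQ x y e; rewrite E1 E1' !mem_cat eD eD' !orbT => /(_ isT isT).
    by rewrite !before_cat neu => /eqP; rewrite eqseq_cat // eqxx => /eqP.
  + have -> : graft Q u T A y = Q y by rewrite /graft Ay.
    by move=> hx hy; apply: mixed; rewrite ?Ay.
  + have -> : graft Q u T A x = Q x by rewrite /graft Ax.
    by move=> hx hy; apply/esym; apply: mixed; rewrite ?Ax.
  + by rewrite /graft Ax Ay; apply: coh_before.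
- move=> e p q x y pq; rewrite !mem_graft //.
  have [eT|neT] := boolP (e \in T); last by rewrite !andbF !orbF; apply: coh_conv.
  by rewrite !andbT; apply: convT.
Qed.

(** [u = w] stands for an absent edge and excludes no node. *)
Definition okside (u w x : node) : bool := (u == w) || side u w x.

Lemma okside_convex u w : u = w \/ adj u w -> convex (okside u w).
Proof.
rewrite /okside; case => [-> |uw] p q x y pq; first by rewrite eqxx.
rewrite (negbTE (adj_neq uw)) /= (sideN _ pq) => hx hy spx spy.
exact: (side_convex uw pq hx hy spx spy).
Qed.

Lemma okside_self u w : okside u w u.
Proof. by rewrite /okside side_self orbT. Qed.

Lemma okside_other u w : adj u w -> okside u w w = false.
Proof. by move=> h; rewrite /okside (negbTE (adj_neq h)) side_other. Qed.

Lemma okside_eq u w x z : u = w \/ adj u w -> adj x z ->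
  (x = u -> z = w -> False) -> (x = w -> z = u -> False) -> okside u w x = okside u w z.
Proof.
rewrite /okside; case => [-> |uw] xz n1 n2; first by rewrite eqxx.
rewrite (negbTE (adj_neq uw)) /=; apply: side_adj_eq => //; apply/eqP => -[E1 E2].
  exact: n1.
exact: n2.
Qed.

(* The nodes whose determined queue changes when [u] is visited by a message
   from [w] while pointing to [y]; [w = u] encodes a request issued at [u], and
   [y = u] that [u] holds the tail of the queue. *)
Definition region (Q : node -> seq nat) (u w y : node) : pred node :=
  fun x => [&& prefix (Q u) (Q x), okside u w x & okside u y x].

Lemma region_convex Q u w y : coherent Q -> u = w \/ adj u w -> u = y \/ adj u y ->
  convex (region Q u w y).
Proof.
move=> cQ uw uy p q a b pq /and3P [a1 a2 a3] /and3P [b1 b2 b3] sa sb.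
have [c2 d2] := okside_convex uw pq a2 b2 sa sb.
have [c3 d3] := okside_convex uy pq a3 b3 sa sb.
rewrite !(coh_prefix_last _ _ cQ) in a1 b1.
have [c1 d1] := coh_conv cQ pq a1 b1 sa sb.
by rewrite /region !(coh_prefix_last _ _ cQ) c1 c2 c3 d1 d2 d3.
Qed.

Lemma region_graft_coherent Q u w y i T' (T := i :: T') :
  coherent Q -> u = w \/ adj u w -> u = y \/ adj u y ->
  uniq (Q u ++ T) ->
  (forall x e, e \in T -> e \in Q x -> adj u w /\ Q w = Q u ++ T) ->
  coherent (graft Q u T (region Q u w y)).
Proof.
move=> cQ uw uy uT hT.
have preT x e : e \in T -> e \in Q x -> before e (Q x) = before e (Q u ++ T).
  move=> eT ex; have [auw <-] := hT x e eT ex; apply: coh_before => //.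
  by rewrite (hT x e eT ex).2 mem_cat eT orbT.
have eu e : e \in T -> e \notin Q u.
  by move=> eT; move: uT; rewrite cat_uniq => /and3P [_ /hasPn /(_ e eT)].
(* An entry of [T] known on the side of [u] would, by convexity, be known at [u]. *)
have sideT x e : e \in T -> e \in Q x -> side w u x.
  move=> eT ex; have [auw Ew] := hT x e eT ex.
  rewrite (sideN _ auw); apply/negP => sx.
  have ew : e \in Q w by rewrite Ew mem_cat eT orbT.
  have := coh_conv cQ auw ex ew sx (side_self _ _).
  by case=> h _; have := eu e eT; rewrite h.
apply: graft_coherent => //.
- by move=> x /and3P [].
- move=> x e /and3P [_ ok _] eT; apply/negP => ex.
  have [auw _] := hT x e eT ex; have := sideT x e eT ex.
  by move: ok; rewrite /okside (negbTE (adj_neq auw)) /= (sideN _ auw) => ->.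
(* A shared entry behind [Q u] makes [Q u] a prefix of [Q z]. So [z] lies across one of the two
   edges at [u], and by convexity [u] knows the entry. *)
- move=> x z e /and3P [px okw oky] nAz ex ez; apply/negPn/negP => neu.
  have pz : prefix (Q u) (Q z).
    have := coh_before cQ ex ez; case/prefixP: px ex => D E; rewrite E => ex.
    rewrite before_cat (negbTE neu) => Ez; have [r ->] := before_split ez.
    by rewrite -Ez -catA; apply: prefix_prefix.
  have key b : u = b \/ adj u b -> okside u b x -> ~~ okside u b z -> False.
    rewrite /okside; case => [-> |ub]; first by rewrite eqxx.
    rewrite (negbTE (adj_neq ub)) /= => sx; rewrite -(sideN _ ub) => sz.
    by have [h _] := coh_conv cQ ub ex ez sx sz; rewrite h in neu.
  move: nAz; rewrite /region pz /= negb_and => /orP []; exact: key.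
- move=> e eT p q x z pq; have rc := region_convex cQ uw uy pq.
  have nc := coh_conv cQ (e := e) pq.
  have Au : region Q u w y u by rewrite /region prefix_refl !okside_self.
  (* From [a] to [b] one can go through [w] and [u]; the given edge separates one of the three
     consecutive pairs. *)
  have mix a b : e \in Q a -> region Q u w y b -> side p q a != side p q b ->
      (e \in Q p) || region Q u w y p /\ (e \in Q q) || region Q u w y q.
    move=> ea Ab sab; have [auw Ew] := hT a e eT ea.
    have ew : e \in Q w by rewrite Ew mem_cat eT orbT.
    case E: (side p q w == side p q u); last first.
      have [E'|E'] : (p = w /\ q = u) \/ (p = u /\ q = w).
        have wu : adj w u by rewrite adjC.
        case sww: (side p q w) E => E.
          have su : ~~ side p q u by case: side E.
          by have [-> ->] := side_step pq wu sww su; left.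
        have su : side p q u by case: side E.
        by have [-> ->] := side_step pq auw su (negbT sww); right.
      + by case: E' => -> ->; rewrite ew Au orbT.
      + by case: E' => -> ->; rewrite ew Au orbT.
    have [E1|E1] := eqVneq (side p q a) (side p q w).
      have ub : side p q u != side p q b by rewrite -(eqP E) -E1.
      case su: (side p q u) ub => ub.
        have sb : side q p b by rewrite (sideN _ pq); case: side ub.
        by have [-> ->] := rc _ _ Au Ab su sb; rewrite !orbT.
      have sb : side p q b by case: side ub.
      have su' : side q p u by rewrite (sideN _ pq) su.
      by have [-> ->] := rc _ _ Ab Au sb su'; rewrite !orbT.
    case sp: (side p q a) E1 => E1.
      have sb : side q p w by rewrite (sideN _ pq); case: side E1.
      by have [-> ->] := nc _ _ ea ew sp sb.
    have sb : side p q w by case: side E1.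
    have sp' : side q p a by rewrite (sideN _ pq) sp.
    by have [-> ->] := nc _ _ ew ea sb sp'.
  move=> hx hz sx sz.
  have ne : side p q x != side p q z by rewrite sx; move: sz; rewrite (sideN _ pq); case: side.
  case/orP: hx => hx; case/orP: hz => hz.
  + by have [-> ->] := nc _ _ hx hz sx sz.
  + exact: (mix x z).
  + by apply: (mix z x) => //; rewrite eq_sym.
  + by have [-> ->] := rc _ _ hx hz sx sz; rewrite !orbT.
Qed.

(** * The Arrow invariant *)

Lemma upd_same T (f : node -> T) x y : upd f x y x = y.
Proof. by rewrite /upd eqxx. Qed.

Lemma upd_other T (f : node -> T) x y z : z <> x -> upd f x y z = f z.
Proof. by move=> ne; rewrite /upd; case: eqP. Qed.

Section Protocol.

Variables (h : nat) (Rq : seq (seq nat * R)).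

Definition heads (ms : seq message) : seq nat := [seq m.1.1.1 | m <- ms].

(* Request [e] is queued behind the last entry of [l]; the final clause is the
   nearest-neighbour property of the queueing order. *)
Definition ordered_after (o : nat -> option (nat * R)) (e : nat) (l : seq nat) : Prop :=
  exists t, [/\ o e = Some (last 0%N l, t), rtime Rq e <= t, rtime Rq (last 0%N l) <= t
    & forall j, (j < size Rq)%N -> j \notin l ->
        t <= rtime Rq j + dT h (rnode Rq j) (rnode Rq (last 0%N l))].

(* [inv_link], [inv_msg]: queues agree along links, and a message [find(i)] from
   [w] to [u] announces that [i] and its followers come after all of [Q u].
   [inv_dir]: links lead to the holder of the last request of the queue.
   [inv_glue]: nothing can be inserted any more between [a] and its successor.
   [inv_arr]: a message is at least as early as a signal that travels at full
   delay from any request on its side that its receiver does not know. *)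
Record arrow_inv (s : state) (Q : node -> seq nat) : Prop := Inv {
  inv_coh : coherent Q;
  inv_madj : forall i w u arr, List.In (i, w, u, arr) (msgs s) -> adj w u;
  inv_edge : forall x y, adj x y -> link s x = y \/ link s y = x \/
    exists i arr, List.In (i, x, y, arr) (msgs s) \/ List.In (i, y, x, arr) (msgs s);
  inv_anti : forall x, link s x <> x -> link s (link s x) <> x;
  inv_link : forall x, Q (link s x) = Q x;
  inv_msg : forall i w u arr, List.In (i, w, u, arr) (msgs s) ->
    exists l, Q w = Q u ++ i :: l;
  inv_heads : uniq (heads (msgs s));
  inv_pend : uniq (pend s) /\ (forall j : nat, j \in pend s -> (j < size Rq)%N);
  inv_iss : forall x (e : nat), e \in Q x ->
    [/\ (e < size Rq)%N, e \notin pend s & rtime Rq e <= now s];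
  inv_own : forall e, (e < size Rq)%N -> e \notin pend s -> e \in Q (rnode Rq e);
  inv_dir : forall x, let v := rnode Rq (last 0%N (Q x)) in
    (x = v /\ link s x = x /\ lastq s x = last 0%N (Q x)) \/
    (x <> v /\ adj x (link s x) /\ side (link s x) x v);
  inv_out : forall x (e : nat), e \in Q x -> e <> 0%N ->
    e \in heads (msgs s) \/ ordered_after (out s) e (before e (Q x));
  inv_glue : forall (e a : nat) t, out s e = Some (a, t) ->
    a \notin pend s /\ forall x, a \in Q x -> e \in Q x;
  inv_arr : forall i w u arr j, List.In (i, w, u, arr) (msgs s) ->
    (j < size Rq)%N -> j \notin pend s -> j \notin Q u -> side w u (rnode Rq j) ->
    arr <= rtime Rq j + dT h (rnode Rq j) u;
  inv_delay : forall i w u arr, List.In (i, w, u, arr) (msgs s) -> arr <= now s + dT h w u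
}.

Lemma inv_adj s Q x : arrow_inv s Q -> link s x = x \/ adj x (link s x).
Proof. by move=> I; have [[_ [-> _]]|[_ [h1 _]]] := inv_dir I x; [left|right]. Qed.

Lemma last_in_Q s Q x : arrow_inv s Q -> last 0%N (Q x) \in Q x.
Proof. by move=> I; have [l ->] := coh_head (inv_coh I) x; rewrite /= mem_last. Qed.

(* A request unknown at [x] is blocked, on its way from its node to [x], by a
   message in transit that is at least as early as the request's own signal. *)
Lemma unknown_request_late s Q tau j x : arrow_inv s Q ->
  (forall i w u arr, List.In (i, w, u, arr) (msgs s) -> tau <= arr) ->
  (forall k, k \in pend s -> tau <= rtime Rq k) ->
  (j < size Rq)%N -> j \notin Q x -> tau <= rtime Rq j + dT h (rnode Rq j) x.
Proof.
move=> I hm hp jn jx; case jp: (j \in pend s).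
  by have := hp j jp; have := dT_ge0 h (rnode Rq j) x; lra.
have jown := inv_own I jn (negbT jp).
have [p [q [pq jpp jq sp sq]]] := @path_boundary (fun z => j \in Q z) _ _ jown jx.
have [E|[E|[i [arr [Hm|Hm]]]]] := inv_edge I pq.
- by move: jq; rewrite -E (inv_link I) jpp.
- by move: jq; rewrite -(inv_link I q) E jpp.
- have := inv_arr I Hm jn (negbT jp) jq sp; have := hm _ _ _ _ Hm.
  by have := dT_cut h pq sp sq; lra.
- by have [l E] := inv_msg I Hm; move: jq; rewrite E mem_cat jpp.
Qed.

Lemma In_head_inj (ms : seq message) m m' : uniq (heads ms) -> List.In m ms -> List.In m' ms ->
  m.1.1.1 = m'.1.1.1 -> m = m'.
Proof.
have mem x l : List.In x l -> x.1.1.1 \in heads l.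
  by elim: l => //= y l IH [->|/IH]; rewrite inE ?eqxx // => ->; rewrite orbT.
elim: ms => //= y l IH /andP [ny U] [E1|h1] [E2|h2] E.
- by rewrite -E1.
- by move: ny; rewrite E1 E mem.
- by move: ny; rewrite E2 -E mem.
exact: IH.
Qed.

Lemma mem_heads i w u arr (ms : seq message) : List.In (i, w, u, arr) ms -> i \in heads ms.
Proof. by elim: ms => //= y l IH [->|/IH]; rewrite inE ?eqxx // => ->; rewrite orbT. Qed.

(** Otherwise some edge on the way from [w] to [x] carries a message beyond which [i] is unknown. It
    is not [find(i)], and it places the last entry of [Q u] behind all that its receiver knows,
    against convexity. *)
Lemma tail_side_known s Q i w u arr x : arrow_inv s Q -> List.In (i, w, u, arr) (msgs s) ->
  last 0%N (Q u) \in Q x -> side w u x -> i \in Q x.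
Proof.
move=> I Hm ax sx; apply/negPn/negP => ix.
have cQ := inv_coh I; have wu := inv_madj I Hm; have [l Ew] := inv_msg I Hm.
have iw : i \in Q w by rewrite Ew mem_cat mem_head orbT.
have aw : last 0%N (Q u) \in Q w by rewrite Ew mem_cat (last_in_Q _ I).
have [p [q [pq ip iq sp sq]]] := @path_boundary (fun z => i \in Q z) _ _ iw ix.
have [_ aq] := coh_conv cQ pq aw ax sp sq.
have [E|[E|[i3 [arr3 [Hm3|Hm3]]]]] := inv_edge I pq.
- by move: iq; rewrite -E (inv_link I) ip.
- by move: iq; rewrite -(inv_link I q) E ip.
- have [l3 E3] := inv_msg I Hm3.
  case: (eqVneq i3 i) => [E|ne].
    rewrite E in Hm3; have [Ep Eq _] := In_head_inj (inv_heads I) Hm3 Hm erefl.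
    by move: sq; rewrite Ep Eq (sideN _ wu) sx.
  have Epre : before i (Q p) = Q u.
    rewrite (coh_before cQ ip iw) Ew before_cat before_cons eqxx cats0.
    by have := coh_uniq cQ w; rewrite Ew cat_uniq /= negb_or => /and3P [_ /andP [/negbTE ->]].
  move: Epre; rewrite E3 before_cat (negbTE iq) before_cons (negbTE ne) => Eu.
  have : last 0%N (Q u) \in i3 :: before i l3 by rewrite -Eu last_cat /= mem_last.
  move=> al; have := coh_uniq cQ p; rewrite E3 cat_uniq => /and3P [_ /hasPn hn _].
  have /hn : last 0%N (Q u) \in i3 :: l3.
    by move: al; rewrite !inE => /orP [->//|/mem_before ->]; rewrite orbT.
  by rewrite aq.
- by have [l3 E3] := inv_msg I Hm3; move: iq; rewrite E3 mem_cat ip.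
Qed.

(** Later insertions only shrink the set of requests that the nearest-neighbour clause concerns. *)
Lemma ordered_mono oo e l l' : last 0%N l = last 0%N l' -> {subset l <= l'} ->
  ordered_after oo e l -> ordered_after oo e l'.
Proof.
move=> El sl [t [h1 h2 h3 h4]]; exists t; rewrite -El; split => // j jn jl.
by apply: h4 => //; apply: contra jl; apply: sl.
Qed.

(** * One event: a new request or a message visits the node [u] *)

Section Visit.

Variables (lk : node -> node) (lq : node -> nat) (ms : seq message) (pd : seq nat)
  (nw : R) (o : nat -> option (nat * R)) (Q : node -> seq nat).
Let s := State lk lq ms pd nw o.
Hypothesis I : arrow_inv s Q.

Variables (i : nat) (w u : node) (tau : R) (T' : seq nat) (ms0 ms' : seq message)
  (pd' : seq nat) (lq' : node -> nat) (o' : nat -> option (nat * R)).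
Let T := i :: T'.
Let y := lk u.

Hypothesis tau_now : nw <= tau.
Hypothesis tau_msgs : forall i w u arr, List.In (i, w, u, arr) ms -> tau <= arr.
Hypothesis tau_pend : forall k, k \in pd -> tau <= rtime Rq k.

(** Either a request is issued at [u] and [T] is this one fresh entry, or a message from [w] brings
    the entries [T] that [w] knows beyond [Q u]. *)
Hypothesis from :
  (u = w /\ T' = [::] /\ rnode Rq i = u /\ rtime Rq i = tau /\ i \in pd /\ lq' u = i)
  \/ (adj w u /\ Q w = Q u ++ T /\ List.In (i, w, u, tau) ms /\ i \notin pd).
Hypothesis ms0_sub : forall m, List.In m ms0 -> List.In m ms.
Hypothesis ms0_heads : uniq (i :: heads ms0).
Hypothesis ms_sub : forall m, List.In m ms -> List.In m ms0 \/ (m = (i, w, u, tau) /\ adj w u).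
Hypothesis heads_sub : forall e, e \in heads ms -> e = i \/ e \in heads ms0.
Hypothesis pd'_uniq : uniq pd'.
Hypothesis pd'_mem : forall j, (j \in pd') = (j \in pd) && (j != i).
Hypothesis lq'_eq : forall x, x <> u -> lq' x = lq x.

Hypothesis to :
  (y = u /\ ms' = ms0 /\ o' = updo o i (Some (lq u, tau))) \/
  (y <> u /\ exists arr', arr' <= tau + dT h u y /\ ms' = (i, u, y, arr') :: ms0 /\ o' = o).

Let A := region Q u w y.
Let Q' := graft Q u T A.
Let s' := State (upd lk u w) lq' ms' pd' tau o'.

Lemma visit_uw : u = w \/ adj u w.
Proof. by case: from => [[-> _]|[wu _]]; [left|right; rewrite adjC]. Qed.

Lemma visit_uy : u = y \/ adj u y.
Proof. by have [/= E|h1] := inv_adj u I; [left|right]. Qed.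

Lemma visit_Au : A u.
Proof. by rewrite /A /region prefix_refl !okside_self. Qed.

Lemma visit_prefix x : A x -> prefix (Q u) (Q x).
Proof. by case/and3P. Qed.

Lemma visit_iN : i \notin Q u.
Proof.
case: from => [[_ [_ [_ [_ [ip _]]]]]|[wu [Ew _]]].
  by apply/negP => /(inv_iss I) [_ /= /negP].
have := coh_uniq (inv_coh I) w; rewrite Ew cat_uniq => /and3P [_ /hasPn hn _].
by apply: hn; apply: mem_head.
Qed.

Lemma visit_uniqT : uniq (Q u ++ T).
Proof.
case: from => [[_ [E _]]|[wu [Ew _]]]; last by rewrite -Ew; apply: (coh_uniq (inv_coh I)).
by rewrite /T E cats1 rcons_uniq visit_iN (coh_uniq (inv_coh I)).
Qed.

Lemma visit_Tknown x e : e \in T -> e \in Q x -> adj u w /\ Q w = Q u ++ T.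
Proof.
case: from => [[_ [E [_ [_ [ip _]]]]]|[wu [Ew _]]]; last by rewrite adjC.
rewrite /T E inE => /eqP -> /(inv_iss I) [_ /=]; by rewrite ip.
Qed.

Lemma visit_coh : coherent Q'.
Proof.
exact: (region_graft_coherent (inv_coh I) visit_uw visit_uy visit_uniqT visit_Tknown).
Qed.

Lemma visit_mem x e : (e \in Q' x) = (e \in Q x) || (A x && (e \in T)).
Proof. by rewrite mem_graft //; apply: visit_prefix. Qed.

Lemma visit_mono x e : e \in Q x -> e \in Q' x.
Proof. by rewrite visit_mem => ->. Qed.

Lemma visit_Q'u : Q' u = Q u ++ T.
Proof. by rewrite /Q' /graft visit_Au drop_size cats0. Qed.

Lemma visit_id x : ~~ A x -> Q' x = Q x.
Proof. by rewrite /Q' /graft => /negbTE ->. Qed.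

Lemma visit_Aw : adj w u -> ~~ A w.
Proof. by rewrite adjC => h1; rewrite /A /region okside_other // andbF. Qed.

Lemma visit_Ay : y <> u -> ~~ A y.
Proof. by case: visit_uy => [->//|h1] _; rewrite /A /region okside_other // !andbF. Qed.

Lemma visit_Qy : Q y = Q u.
Proof. exact: (inv_link I u). Qed.

Lemma visit_Qw : adj w u -> Q w = Q u ++ T.
Proof. by case: from => [[-> _]|[_ []//]] /adj_neq; rewrite eqxx. Qed.

Lemma visit_QwN : adj w u -> Q w <> Q u.
Proof.
by move=> /visit_Qw -> E; have := congr1 size E; rewrite size_cat /=; lia.
Qed.

Lemma visit_lkw : adj w u -> lk w <> u.
Proof. by move=> wu E; apply: (visit_QwN wu); rewrite -(inv_link I w) /= E. Qed.

Lemma visit_wu : w <> u -> adj w u.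
Proof. by case: from => [[-> //]|[]]. Qed.

(** The region is bounded inside the prefix condition only by the edges from [u] to [w] and [y], and
    no old link leads from these back to [u]. Hence linked nodes change alike, and [u] now agrees
    with [w]. *)
Lemma visit_link' x : Q' (upd lk u w x) = Q' x.
Proof.
rewrite /upd; case: eqP => [->|xu].
  have [<- //|uw] := visit_uw; have wu : adj w u by rewrite adjC.
  by rewrite visit_Q'u (visit_id (visit_Aw wu)) (visit_Qw wu).
have [/= -> //|xz] := inv_adj x I; rewrite /= in xz.
have EQ : Q (lk x) = Q x := inv_link I x.
suff EA : A x = A (lk x) by rewrite /Q' /graft -EA EQ.
rewrite /A /region EQ; congr (_ && _); congr (_ && _).
  apply: okside_eq visit_uw xz _ _ => [//|Ex Ez].
  by apply: visit_lkw; [apply: visit_wu; rewrite -Ex|rewrite -Ex].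
apply: okside_eq visit_uy xz _ _ => [//|Ex Ez].
have hy : lk u <> u by rewrite -/y -Ex.
by apply: (inv_anti I (x := u)) => //=; rewrite -/y -Ex.
Qed.

Lemma visit_edge' x z : adj x z -> upd lk u w x = z \/ upd lk u w z = x \/
    exists j arr, List.In (j, x, z, arr) ms' \/ List.In (j, z, x, arr) ms'.
Proof.
have sub m : List.In m ms0 -> List.In m ms'.
  by case: to => [[_ [-> _]]|[_ [arr' [_ [-> _]]]]] //; right.
have half a b : adj a b -> lk a = b -> upd lk u w a = b \/
    exists j arr, List.In (j, a, b, arr) ms'.
  rewrite /upd; case: eqP => [-> ub E|_ _ ->]; last by left.
  right; case: to => [[E' _]|[_ [arr' [_ [-> _]]]]].
    by move: (adj_neq ub); rewrite -E -/y E' eqxx.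
  by exists i, arr'; left; rewrite /y E.
move=> xz; have zx : adj z x by rewrite adjC.
have [/= E|[/= E|[j [arr /= Hm]]]] := inv_edge I xz.
- have [Eh|[j [arr Hm]]] := half _ _ xz E; first by left.
  by right; right; exists j, arr; left.
- have [Eh|[j [arr Hm]]] := half _ _ zx E; first by right; left.
  by right; right; exists j, arr; right.
case: Hm => Hm; have [/sub Hm'|[[E1 E2 E3 E4] wu]] := ms_sub Hm.
- by right; right; exists j, arr; left.
- by right; left; rewrite /upd E3 eqxx E2.
- by right; right; exists j, arr; right.
- by left; rewrite /upd E3 eqxx E2.
Qed.

Lemma visit_anti' x : upd lk u w x <> x -> upd lk u w (upd lk u w x) <> x.
Proof.
case: (eqVneq x u) => [->|/eqP xu]; rewrite ?upd_same ?(upd_other _ _ xu).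
  by move=> wu; rewrite upd_other //; apply: visit_lkw; apply: visit_wu.
case: (eqVneq (lk x) u) => [E|/eqP nu] nx; last by rewrite upd_other //; apply: (inv_anti I).
rewrite E upd_same => Ew; apply: visit_lkw; last by rewrite Ew.
by apply: visit_wu; rewrite Ew.
Qed.

Lemma visit_old_msg i2 w2 z arr : List.In (i2, w2, z, arr) ms0 -> exists l, Q' w2 = Q' z ++ i2 :: l.
Proof.
move=> Hm0; have Hm := ms0_sub Hm0.
have ne : i2 <> i.
  move=> E; move: ms0_heads; rewrite /= => /andP [/negP []].
  by rewrite -E; apply: mem_heads Hm0.
have wz := inv_madj I Hm; have [l El] := inv_msg I Hm.
have sz (a b : node) : Q a = Q b ++ i2 :: l -> Q a <> Q b.
  by move=> -> E; have := congr1 size E; rewrite size_cat /=; lia.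
have Ek : okside u w w2 = okside u w z.
  apply: (okside_eq visit_uw wz) => E1 E2; rewrite E1 E2 in El wz.
    have wu : adj w u by rewrite adjC.
    have := congr1 size El; rewrite (visit_Qw wu) !size_cat /=; lia.
  move: El; rewrite (visit_Qw wz) => /eqP; rewrite eqseq_cat // eqxx /= => /eqP [E _].
  by apply: ne.
have Ey : okside u y w2 = okside u y z.
  by apply: okside_eq visit_uy wz _ _ => E1 E2; apply: (sz w2 z El); rewrite E1 E2 visit_Qy.
have [Az|nAz] := boolP (A z).
  have [D [E1 E2]] := graft_split T visit_prefix Az.
  have Aw : A w2.
    move: Az; rewrite /A /region Ek Ey => /and3P [pz -> ->].
    by rewrite !andbT El; apply: prefix_trans pz (prefix_prefix _ _).
  exists l; rewrite /Q' E2 /graft Aw El E1 -!catA drop_size_cat //.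
rewrite (visit_id nAz); have [Aw|nAw] := boolP (A w2); last by exists l; rewrite (visit_id nAw).
have [D [E1 E2]] := graft_split T visit_prefix Aw; rewrite /Q' E2.
(* Only the sender changes. Its receiver knows a proper prefix of [Q u], so [T] is inserted behind
   [i2]. *)
have pu : ~~ prefix (Q u) (Q z).
  by move: Aw nAz; rewrite /A /region Ek Ey => /and3P [_ -> ->]; rewrite !andbT.
have /orP [|/prefixP [r Er]] : prefix (Q u) (Q z) || prefix (Q z) (Q u).
  by apply: (@prefix_comparable _ _ (Q w2)); [rewrite E1|rewrite El]; apply: prefix_prefix.
  by rewrite (negbTE pu).
move: E1; rewrite El Er -catA => /eqP; rewrite eqseq_cat // eqxx /=.
case: r Er => [|b r] Er; first by move: pu; rewrite Er cats0 prefix_refl.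
by rewrite /= eqseq_cons => /andP [/eqP <- _]; exists (r ++ T ++ D); rewrite -catA.
Qed.

Lemma visit_msg' j a b arr : List.In (j, a, b, arr) ms' -> exists l, Q' a = Q' b ++ j :: l.
Proof.
case: to => [[_ [-> _]]|[yu [arr' [_ [-> _]]]]]; first exact: visit_old_msg.
case=> [[<- <- <- _]|]; last exact: visit_old_msg.
by exists T'; rewrite visit_Q'u (visit_id (visit_Ay yu)) visit_Qy.
Qed.

Lemma visit_heads' : uniq (heads ms').
Proof.
case: to => [[_ [-> _]]|[_ [arr' [_ [-> _]]]]] //.
by move: ms0_heads => /andP [].
Qed.

Lemma visit_madj' j a b arr : List.In (j, a, b, arr) ms' -> adj a b.
Proof.
case: to => [[_ [-> _]]|[yu [arr' [_ [-> _]]]]]; first by move/ms0_sub; apply: (inv_madj I).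
case=> [[_ <- <- _]|]; last by move/ms0_sub; apply: (inv_madj I).
by case: visit_uy => // E; case: yu.
Qed.

Lemma visit_i_issued : [/\ (i < size Rq)%N, i \notin pd' & rtime Rq i <= tau].
Proof.
rewrite pd'_mem eqxx andbF; case: from => [[_ [_ [_ [-> [ip _]]]]]|[wu [Ew [Hm ip]]]].
  by split; [apply: (inv_pend I).2| |lra].
have : i \in Q w by rewrite Ew mem_cat mem_head orbT.
by case/(inv_iss I) => h1 _ /= h2; split => //; lra.
Qed.

Lemma visit_iss' x e : e \in Q' x -> [/\ (e < size Rq)%N, e \notin pd' & rtime Rq e <= tau].
Proof.
have old z : e \in Q z -> [/\ (e < size Rq)%N, e \notin pd' & rtime Rq e <= tau].
  case/(inv_iss I) => h1 h2 /= h3; rewrite pd'_mem (negbTE h2); split => //; lra.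
rewrite visit_mem => /orP [/old //|/andP [_]].
rewrite inE => /orP [/eqP ->|eT]; first exact: visit_i_issued.
case: from => [[_ [E _]]|[wu [Ew _]]]; first by rewrite E in eT.
by apply: (old w); rewrite Ew mem_cat inE eT !orbT.
Qed.

Lemma visit_new_issued j : j \notin pd' ->
  j \notin pd \/ (j = i /\ rnode Rq i = u /\ rtime Rq i = tau).
Proof.
rewrite pd'_mem negb_and negbK => /orP [|/eqP ->]; first by left.
by case: from => [[_ [_ [-> [-> _]]]]|[_ [_ [_ ->]]]]; [right|left].
Qed.

Lemma visit_own' e : (e < size Rq)%N -> e \notin pd' -> e \in Q' (rnode Rq e).
Proof.
move=> en /visit_new_issued [ep|[-> [-> _]]]; first exact/visit_mono/(inv_own I).
by rewrite visit_Q'u mem_cat mem_head orbT.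
Qed.

(** After a message the new tail lies beyond [w], because the link of [w] does not lead back to
    [u]. *)
Lemma visit_tail_node : let v := rnode Rq (last 0%N (Q u ++ T)) in
  (u = w /\ v = u /\ lq' u = last 0%N (Q u ++ T)) \/ (adj w u /\ side w u v).
Proof.
rewrite last_cat /=; case: from => [[Ew [-> [Ei [_ [_ El]]]]]|[wu [Ew [Hm _]]]]; first by left.
right; split => //; have -> : last i T' = last 0%N (Q w) by rewrite Ew last_cat.
have [[/= <- _]|[/= nv [adw sd]]] := inv_dir I w; first exact: side_self.
have ne : lk w != u by apply/eqP; exact: (visit_lkw wu).
exact: side_trans adw wu ne sd.
Qed.

Lemma visit_dir' x : let v := rnode Rq (last 0%N (Q' x)) in
    (x = v /\ upd lk u w x = x /\ lq' x = last 0%N (Q' x)) \/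
    (x <> v /\ adj x (upd lk u w x) /\ side (upd lk u w x) x v).
Proof.
case: (eqVneq x u) => [->|/eqP xu].
  rewrite visit_Q'u /upd eqxx; have [[<- [-> ->]]|[wu sv]] := visit_tail_node; first by left.
  right; split; last by rewrite adjC.
  by move=> E; move: sv; rewrite -E side_other.
have -> : upd lk u w x = lk x by rewrite /upd; case: eqP.
rewrite (lq'_eq xu).
have [Ax|nAx] := boolP (A x); last by rewrite (visit_id nAx); apply: (inv_dir I).
have [D [E1 E2]] := graft_split T visit_prefix Ax; rewrite /Q' E2.
case/lastP: D E1 {E2} => [|D b] E1; last first.
  have -> : last 0%N (Q u ++ T ++ rcons D b) = last 0%N (Q x).
    by rewrite E1 -!rcons_cat !last_rcons.
  exact: (inv_dir I).
rewrite cats0 in E1; rewrite cats0.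
have /and3P [_ okw oky] := Ax.
set v := rnode _ _.
have vP := visit_tail_node; rewrite /= -/v in vP.
(* As [Q x = Q u], the link of [x] led to the old tail. Within the region the way there passes
   through [u], from where the new tail is reached. *)
have [axz sxu] : adj x (lk x) /\ side (lk x) x u.
  have := inv_dir I x; have := inv_dir I u; rewrite /= E1.
  case=> [[<- _]|[nva [ayu sya]]].
    by case=> [[E _]|[_ []]].
  rewrite -/y in ayu sya; have yu : adj y u by rewrite adjC.
  have sux : side u y x by move: oky; rewrite /okside (negbTE (adj_neq ayu)).
  case=> [[E _]|[_ [axz sza]]].
    by move: sya; rewrite -E (sideN _ ayu) sux.
  split => //; apply/negPn/negP => nsu.
  have zx : adj (lk x) x by rewrite adjC.
  rewrite -(sideN _ zx) in nsu.
  have sxy : side x (lk x) y.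
    by apply/negPn/negP => ns; have [E _] := side_step axz ayu nsu ns; apply: xu.
  have nsa : ~~ side x (lk x) (rnode Rq (last 0%N (Q u))).
    by rewrite -(sideN _ axz).
  have [] := side_convex yu axz (side_self _ _) sya sxy nsa.
  by rewrite (sideN _ ayu) sux.
right.
case: vP => [[_ [Ev _]]|[wu sv]]; first by rewrite Ev.
have uw : adj u w by rewrite adjC.
have sux : side u w x by move: okw; rewrite /okside (negbTE (adj_neq uw)).
have nsv : ~~ side u w v by rewrite -(sideN _ uw).
split; first by move=> E; move: nsv; rewrite -E sux.
split => //; apply/negPn/negP => nsz.
have zx : adj (lk x) x by rewrite adjC.
rewrite -(sideN _ zx) in nsz.
have [] := side_convex axz uw (side_self _ _) nsz sux nsv.
by rewrite (sideN _ zx) sxu.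
Qed.

(** The predecessor was issued at [u] itself, so the nearest-neighbour clause is
    [unknown_request_late] at [u]. *)
Lemma visit_ordered_i : y = u -> ordered_after o' i (Q u).
Proof.
move=> yu; case: to => [[_ [_ ->]]|[]//]; exists tau.
have [[/= Ev [_ El]]|[_ [/adj_neq]]] := inv_dir I u; last by rewrite /= -/y yu eqxx.
have [k1 _ k2] := visit_i_issued; split => //.
- by rewrite /updo eqxx El.
- by have [_ _ /=] := inv_iss I (last_in_Q u I); lra.
- move=> j jn ju; rewrite -Ev; exact: (unknown_request_late I).
Qed.

Lemma visit_out' x e : e \in Q' x -> e <> 0%N ->
  e \in heads ms' \/ ordered_after o' e (before e (Q' x)).
Proof.
move=> ex e0; case: (eqVneq e i) => [Ee|/eqP ei].
  have iu : i \in Q' u by rewrite visit_Q'u mem_cat mem_head orbT.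
  rewrite Ee in ex *; rewrite (coh_before visit_coh ex iu) visit_Q'u.
  rewrite before_cat (negbTE visit_iN) before_cons eqxx cats0.
  case: (eqVneq y u) => [yu|/eqP yu]; first by right; apply: visit_ordered_i.
  by left; case: to => [[]//|[_ [arr' [_ [-> _]]]]]; rewrite inE eqxx.
have hsub e' : e' <> i -> e' \in heads ms -> e' \in heads ms'.
  move=> ne /heads_sub [//|hh].
  by case: to => [[_ [-> _]]|[_ [arr' [_ [-> _]]]]] //; rewrite inE hh orbT.
have old z l : last 0%N (before e (Q z)) = last 0%N l -> {subset before e (Q z) <= l} ->
    e \in Q z -> e \in heads ms' \/ ordered_after o' e l.
  move=> El sl ez; have [hh|hh] := inv_out I ez e0; first by left; apply: hsub.
  right; apply: (ordered_mono El sl); case: hh => t [h1 h2 h3 h4]; exists t; split => //.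
  by case: to => [[_ [_ ->]]|[_ [arr' [_ [_ ->]]]]] //; rewrite /updo; case: eqP.
have [Ax|nAx] := boolP (A x); last first.
  by rewrite (visit_id nAx) in ex *; apply: (old x).
have [D [E1 E2]] := graft_split T visit_prefix Ax; rewrite /Q' E2 in ex *.
have [eu|neu] := boolP (e \in Q u); first by rewrite before_cat eu; apply: (old u).
have [eT|neT] := boolP (e \in T).
  have wu : adj w u.
    case: from => [[_ [E _]]|[]//]; move: eT; rewrite /T E inE => /eqP; by move/ei.
  have ew : e \in Q w by rewrite (visit_Qw wu) mem_cat eT orbT.
  by rewrite catA before_cat mem_cat eT orbT -(visit_Qw wu); apply: (old w).
move: ex; rewrite !mem_cat (negbTE neu) (negbTE neT) /= => eD.
have ex : e \in Q x by rewrite E1 mem_cat eD orbT.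
case: D eD E1 {E2} => // d D eD E1.
case: (eqVneq d e) => [Ed|ne].
  (* Here [e] directly follows the last entry of [Q u]. Were it already queued, [inv_glue] would
     make it known at [u]; so it is still in transit. *)
  have [hh|[t [h1 _ _ _]]] := inv_out I ex e0; first by left; apply: hsub.
  move: h1; rewrite E1 before_cat (negbTE neu) before_cons Ed eqxx cats0 => h1.
  by have := (inv_glue I h1).2 _ (last_in_Q u I); rewrite (negbTE neu).
have Eb : before e (Q u ++ T ++ d :: D) = Q u ++ T ++ d :: before e D.
  by rewrite !before_cat (negbTE neu) (negbTE neT) before_cons (negbTE ne).
have Eb' : before e (Q x) = Q u ++ d :: before e D.
  by rewrite E1 before_cat (negbTE neu) before_cons (negbTE ne).
rewrite Eb; apply: (old x); rewrite // Eb'.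
  by rewrite !last_cat.
by move=> j; rewrite !mem_cat => /orP [->//|->]; rewrite !orbT.
Qed.

Lemma visit_glue' (e a : nat) t : o' e = Some (a, t) ->
  a \notin pd' /\ forall x, a \in Q' x -> e \in Q' x.
Proof.
have old : o e = Some (a, t) -> a \notin pd' /\ forall x, a \in Q' x -> e \in Q' x.
  move=> /(inv_glue I) [/= ap gl]; split; first by rewrite pd'_mem (negbTE ap).
  move=> x; rewrite visit_mem => /orP [/gl/visit_mono //|/andP [Ax aT]].
  have wu : adj w u.
    case: from => [[_ [ET [_ [_ [ip _]]]]]|[]//].
    by move: aT ap; rewrite /T ET inE => /eqP ->; rewrite ip.
  have aw : a \in Q w by rewrite (visit_Qw wu) mem_cat aT orbT.
  have := gl _ aw; rewrite (visit_Qw wu) mem_cat visit_mem Ax => /orP [eu|->]; last by rewrite orbT.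
  by have /prefixP [r ->] := visit_prefix Ax; rewrite mem_cat eu.
case: to => [[yu [_ ->]]|[_ [arr' [_ [_ ->]]]]] //.
rewrite /updo; case: eqP => // -> [<- _].
have [[/= _ [_ El]]|[_ [/adj_neq]]] := inv_dir I u; last by rewrite /= -/y yu eqxx.
rewrite El; split.
  by have [_ /= lp _] := inv_iss I (last_in_Q u I); rewrite pd'_mem (negbTE lp).
move=> x ax.
have [Ax|nAx] := boolP (A x); first by rewrite visit_mem Ax mem_head orbT.
rewrite (visit_id nAx) in ax *; move: nAx.
rewrite /A /region (coh_prefix_last _ _ (inv_coh I)) ax /= yu {2}/okside eqxx andbT => nok.
(* Outside the region the tail is known only across the edge to [w], where [tail_side_known]
   applies. *)
case: from => [[Eu _]|[wu [_ [Hm _]]]]; first by move: nok; rewrite /okside Eu eqxx.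
apply: (tail_side_known I Hm) => //.
have uw : adj u w by rewrite adjC.
by rewrite (sideN _ uw); move: nok; rewrite /okside negb_or => /andP [].
Qed.

Lemma visit_arr' j a b arr k : List.In (j, a, b, arr) ms' ->
    (k < size Rq)%N -> k \notin pd' -> k \notin Q' b -> side a b (rnode Rq k) ->
    arr <= rtime Rq k + dT h (rnode Rq k) b.
Proof.
move=> Hm kn kp kb sd.
have late x : k \notin Q x -> tau <= rtime Rq k + dT h (rnode Rq k) x.
  exact: (unknown_request_late I).
have nkb : k \notin Q b by apply: contra kb; apply: visit_mono.
have old : List.In (j, a, b, arr) ms0 -> arr <= rtime Rq k + dT h (rnode Rq k) b.
  move/ms0_sub => Hm0; have ab := inv_madj I Hm0.
  have [kp0|[Ek [Er Et]]] := visit_new_issued kp; first exact: (inv_arr I Hm0).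
  (* A request issued just now behind the sender cannot overtake the message, which is at most one
     edge delay away from arrival. *)
  have /= := inv_delay I Hm0; rewrite (dT_step h ab sd).
  by rewrite Ek Et; have := dT_ge0 h (rnode Rq i) a; lra.
move: Hm; case: to => [[_ [-> _]]|[yu [arr' [harr [-> _]]]]]; first exact: old.
case=> [[_ Ea Eb Earr]|]; last exact: old.
have uy : adj u y by case: visit_uy => // E; case: yu.
rewrite -Ea -Eb in sd; rewrite -Eb -Earr (dT_step h uy sd).
have : k \notin Q u by rewrite -visit_Qy Eb.
by move/late; lra.
Qed.

Lemma visit_delay' j a b arr : List.In (j, a, b, arr) ms' -> arr <= tau + dT h a b.
Proof.
have old : List.In (j, a, b, arr) ms0 -> arr <= tau + dT h a b.
  by move/ms0_sub/(inv_delay I) => /=; lra.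
case: to => [[_ [-> _]]|[yu [arr' [harr [-> _]]]]] //.
by case=> [[_ <- <- <-]|].
Qed.

Lemma visit_inv : arrow_inv s' Q'.
Proof.
split.
- exact: visit_coh.
- exact: visit_madj'.
- exact: visit_edge'.
- exact: visit_anti'.
- exact: visit_link'.
- exact: visit_msg'.
- exact: visit_heads'.
- split => //= j; rewrite pd'_mem => /andP [h1 _]; exact: (inv_pend I).2.
- exact: visit_iss'.
- exact: visit_own'.
- exact: visit_dir'.
- exact: visit_out'.
- exact: visit_glue'.
- exact: visit_arr'.
- exact: visit_delay'.
Qed.

End Visit.
End Protocol.

(** * The initial configuration *)

Definition init_link (v0 z : node) : node := if z == v0 then v0 else toward v0 z.

Lemma init_link_down v0 z a : prefix (rcons z a) v0 -> init_link v0 z = rcons z a.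
Proof.
case/prefixP => l ->; rewrite cat_rcons /init_link.
have -> : (z == z ++ a :: l) = false.
  by apply/negP => /eqP /(congr1 size); rewrite size_cat /=; lia.
rewrite /toward take_size_cat // eqxx size_cat /= addnS ltnS leq_addr /=.
by rewrite -cat_rcons take_size_cat // size_rcons.
Qed.

Lemma init_link_up v0 z a : ~~ prefix (rcons z a) v0 -> init_link v0 (rcons z a) = z.
Proof.
move=> np; rewrite /init_link ifF; last by apply: contraNF np => /eqP ->; apply: prefix_refl.
by move: np; rewrite /toward prefixE => /negbTE ->; rewrite andbF -[RHS](par_rcons z a).
Qed.

Lemma adj_rcons z a : adj (rcons z a) z.
Proof. by rewrite /adj par_rcons eqxx andbT; case: z. Qed.

Lemma init_link_side v0 x : x <> v0 -> adj x (init_link v0 x) /\ side (init_link v0 x) x v0.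
Proof.
move=> ne; have [/prefixP [[|a l] E]|np] := boolP (prefix x v0).
- by case: ne; rewrite E cats0.
- have px : prefix (rcons x a) v0 by rewrite E -cat_rcons prefix_prefix.
  rewrite (init_link_down px) adjC adj_rcons; split => //.
  by rewrite /side /child_end size_rcons ltnNge leqnSn /= prefix_refl px.
case/lastP: x ne np => [|x a] ne np; first by rewrite prefix0s in np.
rewrite (init_link_up np) adj_rcons; split => //.
by rewrite /side /child_end size_rcons ltnSn prefix_rconsN (negbTE np).
Qed.

Lemma init_inv h v0 rs : arrow_inv h (reqs v0 rs) (init_state v0 rs) (fun _ => [:: 0%N]).
Proof.
have lkE : link (init_state v0 rs) = init_link v0 by [].
have edge x a : init_link v0 (rcons x a) = x \/ init_link v0 x = rcons x a.
  have [hp|np] := boolP (prefix (rcons x a) v0); first by right; apply: init_link_down.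
  by left; apply: init_link_up.
split; rewrite ?lkE //=.
- by split => // x; exists [::].
- move=> x y /adjP [[a [-> _]]|[a [-> _]]].
    by have [->|->] := edge y a; [left|right; left].
  by have [->|->] := edge x a; [right; left|left].
- move=> x nx.
  have nv : x <> v0 by move=> E; apply: nx; rewrite E /init_link eqxx.
  have [ax sx] := init_link_side nv; set z := init_link v0 x in ax sx *.
  case: (eqVneq z v0) => [E|/eqP zv].
    by rewrite /init_link E eqxx => E'; apply: nv.
  have [az sz] := init_link_side zv => E; rewrite E in az sz.
  by move: sz; rewrite (sideN _ az) sx.
- by split; [apply: iota_uniq|move=> j; rewrite mem_iota add1n => /andP []].
- by move=> x e; rewrite inE => /eqP ->; rewrite mem_iota; split => //; rewrite /rtime /=; lra.
- move=> e en; rewrite mem_iota add1n en andbT -leqNgt leqn0 inE; exact.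
- move=> x; case: (eqVneq x v0) => [->|/eqP ne]; last by right; split => //; apply: init_link_side.
  by left; rewrite /init_link eqxx.
- by move=> x e; rewrite inE => /eqP ->.
Qed.

(* Holds along every execution that can still be completed, since events are
   processed in the order of their times. *)
Definition timely (Rq : seq (seq nat * R)) (s : state) : Prop :=
  (forall i w u arr, List.In (i, w, u, arr) (msgs s) -> now s <= arr) /\
  (forall j : nat, j \in pend s -> now s <= rtime Rq j).

Lemma In_mid T (x : T) s1 y s2 : List.In x (s1 ++ y :: s2) <-> List.In x (s1 ++ s2) \/ x = y.
Proof.
elim: s1 => [|z s1 IH] /=; first by split => [[->|]|[|->]]; auto.
by rewrite IH; split => [[|[]]|[[]|]]; auto.
Qed.

Lemma heads_mid m1 m m2 e :
  (e \in heads (m1 ++ m :: m2)) = (e == m.1.1.1) || (e \in heads (m1 ++ m2)).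
Proof.
by rewrite /heads !map_cat !mem_cat inE orbCA.
Qed.

Lemma upd_id T (f : node -> T) x : upd f x (f x) = f.
Proof. by apply: functional_extensionality => z; rewrite /upd; case: eqP => [->|]. Qed.

Lemma step_timely h Rq s1 s2 : step h Rq s1 s2 -> timely Rq s2 -> timely Rq s1.
Proof.
case=> [lk lq ms p1 p2 i nw o v h1 _|lk lq ms p1 p2 i nw o arr v h1 _ h2
       |lk lq m1 m2 i w u arr ps nw o h1 _|lk lq m1 m2 i w u arr ps nw o arr' h1 _ h2]
  [/= t1 t2]; split => /=.
- by move=> j a b ar /t1; lra.
- by move=> j; rewrite mem_cat inE orbCA -mem_cat => /orP [/eqP -> //|/t2]; lra.
- by move=> j a b ar hj; have := t1 j a b ar (or_intror hj); lra.
- by move=> j; rewrite mem_cat inE orbCA -mem_cat => /orP [/eqP -> //|/t2]; lra.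
- by move=> j a b ar /In_mid [/t1|[_ _ _ ->]]; lra.
- by move=> j /t2; lra.
- move=> j a b ar /In_mid [hj|[_ _ _ ->]]; last lra.
  by have := t1 _ _ _ _ (or_intror hj); lra.
- by move=> j /t2; lra.
Qed.

Lemma heads_issued h Rq s Q e : arrow_inv h Rq s Q -> e \in heads (msgs s) -> e \notin pend s.
Proof.
move=> I he; have [w [u [arr Hm]]] : exists w u arr, List.In (e, w, u, arr) (msgs s).
  elim: (msgs s) he => //= -[[[j a] b] t] ms IH; rewrite inE /= => /orP [/eqP ->|/IH].
    by exists a, b, t; left.
  by case=> w [u [arr Hm]]; exists w, u, arr; right.
have [l E] := inv_msg I Hm.
by have /(inv_iss I) [] : e \in Q w by rewrite E mem_cat mem_head orbT.
Qed.

Lemma uniq_mid (T : eqType) (s1 : seq T) x s2 : uniq (s1 ++ x :: s2) -> uniq (x :: s1 ++ s2).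
Proof. by rewrite -cat1s uniq_catCA. Qed.

Lemma step_inv h Rq s1 s2 Q : step h Rq s1 s2 -> arrow_inv h Rq s1 Q -> timely Rq s2 ->
  exists Q', arrow_inv h Rq s2 Q'.
Proof.
case=> [lk lq ms p1 p2 i nw o v h1 lv|lk lq ms p1 p2 i nw o arr v h1 lv h2
       |lk lq m1 m2 i w u arr ps nw o h1 lu|lk lq m1 m2 i w u arr ps nw o arr' h1 lu h2]
  I [/= t1 t2].
- have [/= pu pn] := inv_pend I.
  have ip : i \in p1 ++ i :: p2 by rewrite mem_cat mem_head orbT.
  have iH : i \notin heads ms by apply/negP => /(heads_issued I); rewrite /= ip.
  have pu' := uniq_mid pu.
  exists (graft Q v [:: i] (region Q v v (lk v))).
  (* The unchanged link is written as an update, which makes this step a visit with [w = u = v]. *)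
  have Elk : upd lk v v = lk by rewrite -{2}lv upd_id.
  rewrite -[X in State X]Elk.
  apply: (@visit_inv h Rq lk lq ms (p1 ++ i :: p2) nw o Q I i v v (rtime Rq i) [::] ms) => //.
  + by move=> k; rewrite mem_cat inE orbCA -mem_cat => /orP [/eqP ->|/t2]; lra.
  + by left; rewrite /upd eqxx.
  + by rewrite /= iH (inv_heads I).
  + by move=> m; left.
  + by move=> e; right.
  + by case/andP: pu'.
  + move=> j; rewrite !mem_cat inE; case: (eqVneq j i) => [->|]; last by rewrite /= andbT.
    by move: pu'; rewrite /= mem_cat => /andP [/negbTE ->]; rewrite andbF.
  + by move=> x xv; rewrite upd_other.
  + by left.
- have [/= pu pn] := inv_pend I.
  have ip : i \in p1 ++ i :: p2 by rewrite mem_cat mem_head orbT.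
  have iH : i \notin heads ms by apply/negP => /(heads_issued I); rewrite /= ip.
  have pu' := uniq_mid pu.
  exists (graft Q v [:: i] (region Q v v (lk v))).
  apply: (@visit_inv h Rq lk lq ms (p1 ++ i :: p2) nw o Q I i v v (rtime Rq i) [::] ms) => //.
  + by move=> j a b ar hj; apply: (t1 j a b ar); right.
  + by move=> k; rewrite mem_cat inE orbCA -mem_cat => /orP [/eqP ->|/t2]; lra.
  + by left; rewrite /upd eqxx.
  + by rewrite /= iH (inv_heads I).
  + by move=> m; left.
  + by move=> e; right.
  + by case/andP: pu'.
  + move=> j; rewrite !mem_cat inE; case: (eqVneq j i) => [->|]; last by rewrite /= andbT.
    by move: pu'; rewrite /= mem_cat => /andP [/negbTE ->]; rewrite andbF.
  + by move=> x xv; rewrite upd_other.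
  + by right; split => //; exists arr; split => //; lra.
- have Hm : List.In (i, w, u, arr) (m1 ++ (i, w, u, arr) :: m2) by apply/In_mid; right.
  have wu := inv_madj I Hm; have [l Ew] := inv_msg I Hm.
  have ip : i \notin ps by apply: (heads_issued I); apply: mem_heads Hm.
  have hU : uniq (i :: heads (m1 ++ m2)).
    by have := inv_heads I; rewrite /= /heads !map_cat /=; apply: uniq_mid.
  exists (graft Q u (i :: l) (region Q u w (lk u))).
  apply: (@visit_inv h Rq lk lq (m1 ++ (i, w, u, arr) :: m2) ps nw o Q I
    i w u arr l (m1 ++ m2)) => //.
  + by move=> j a b ar /In_mid [/t1|[_ _ _ ->]]; lra.
  + by right.
  + by move=> m hm; apply/In_mid; left.
  + by move=> m /In_mid [?|->]; [left|right].
  + by move=> e; rewrite heads_mid => /orP [/eqP ->|]; [left|right].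
  + by case: (inv_pend I).
  + move=> j; case: (eqVneq j i) => [->|]; last by rewrite andbT.
    by rewrite (negbTE ip).
  + by left.
- have Hm : List.In (i, w, u, arr) (m1 ++ (i, w, u, arr) :: m2) by apply/In_mid; right.
  have wu := inv_madj I Hm; have [l Ew] := inv_msg I Hm.
  have ip : i \notin ps by apply: (heads_issued I); apply: mem_heads Hm.
  have hU : uniq (i :: heads (m1 ++ m2)).
    by have := inv_heads I; rewrite /= /heads !map_cat /=; apply: uniq_mid.
  exists (graft Q u (i :: l) (region Q u w (lk u))).
  apply: (@visit_inv h Rq lk lq (m1 ++ (i, w, u, arr) :: m2) ps nw o Q I
    i w u arr l (m1 ++ m2)) => //.
  + by move=> j a b ar /In_mid [hj|[_ _ _ ->]]; [apply: (t1 j a b ar); right|lra].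
  + by right.
  + by move=> m hm; apply/In_mid; left.
  + by move=> m /In_mid [?|->]; [left|right].
  + by move=> e; rewrite heads_mid => /orP [/eqP ->|]; [left|right].
  + by case: (inv_pend I).
  + move=> j; case: (eqVneq j i) => [->|]; last by rewrite andbT.
    by rewrite (negbTE ip).
  + by right; split => //; exists arr'; split => //; lra.
Qed.

Lemma reach_timely h Rq s1 s2 : reach h Rq s1 s2 -> complete s2 -> timely Rq s1.
Proof.
elim=> [s [hp hm]|s1' s2' s3 st _ IH /IH tm]; first by split; rewrite ?hp ?hm.
exact: step_timely st tm.
Qed.

Lemma reach_inv h Rq s1 s2 Q : reach h Rq s1 s2 -> complete s2 -> arrow_inv h Rq s1 Q ->
  exists Q', arrow_inv h Rq s2 Q'.
Proof.
move=> r; elim: r Q => [s Q _ I|s1' s2' s3 st r IH Q cs I]; first by exists Q.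
by have [Q' I'] := step_inv st I (reach_timely r cs); apply: IH I'.
Qed.

Lemma arrow_order h v0 rs s (Rq := reqs v0 rs) :
  reach h Rq (init_state v0 rs) s -> complete s ->
  exists2 p, perm_eq (0%N :: p) (iota 0 (size Rq)) &
    forall k, (1 <= k < size Rq)%N ->
      ordered_after h Rq (out s) (nth 0%N (0%N :: p) k) (take k (0%N :: p)).
Proof.
move=> r cs; have [Q I] := reach_inv r cs (init_inv h v0 rs).
have [hp hm] := cs; have cQ := inv_coh I.
(* Without messages every edge is crossed by a link, so all lists coincide and form the whole
   queue. *)
have const x : Q x = Q v0.
  apply/eqP/negPn/negP => ne.
  have [p [q [pq /eqP Ep nq _ _]]] := @path_boundary (fun z => Q z == Q v0) _ _ (eqxx _) ne.
  have [E|[E|[i [arr []]]]] := inv_edge I pq; rewrite ?hm //.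
    by move: nq; rewrite -E (inv_link I) Ep eqxx.
  by move: nq; rewrite -(inv_link I q) E Ep eqxx.
have [p Ep] := coh_head cQ v0.
have mem e : (e \in Q v0) = (e < size Rq)%N.
  apply/idP/idP => [/(inv_iss I) [] //|en].
  by rewrite -(const (rnode Rq e)); apply: (inv_own I) => //; rewrite hp.
have U := coh_uniq cQ v0.
have pe : perm_eq (Q v0) (iota 0 (size Rq)).
  by apply: uniq_perm => //; [apply: iota_uniq|move=> e; rewrite mem mem_iota].
exists p; rewrite -Ep //.
have sz : size (Q v0) = size Rq by rewrite (perm_size pe) size_iota.
move=> // k /andP [k1 kn]; have kQ : (k < size (Q v0))%N by rewrite sz.
have := inv_out I (mem_nth 0%N kQ); rewrite hm /before index_uniq // => H.
case: H => // E; have := index_uniq 0%N kQ U; rewrite E Ep /= => E0.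
by rewrite -E0 in k1.
Qed.

(** * Competitiveness *)

Lemma Rsum_perm (f : nat -> R) s1 s2 : perm_eq s1 s2 ->
  Rsum [seq f i | i <- s1] = Rsum [seq f i | i <- s2].
Proof.
elim: s1 s2 => [|x s1 IH] s2 ps; first by rewrite perm_sym in ps; rewrite (perm_nilP ps).
have xs : x \in s2 by rewrite -(perm_mem ps) mem_head.
case/splitPr: xs ps => l1 l2; rewrite perm_sym perm_catC cat_cons perm_cons perm_sym => ps.
rewrite map_cons [LHS]/= (IH _ ps) !map_cat !Rsum_cat /=; lra.
Qed.

Lemma le_foldr_Rmin T (f : T -> R) (B x : R) (s : seq T) :
  B <= x -> (forall y, List.In y s -> B <= f y) -> B <= foldr Rmin x [seq f y | y <- s].
Proof.
move=> hx; elim: s => //= y s IH hs; apply: Rmin_glb; first by apply: hs; left.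
by apply: IH => z hz; apply: hs; right.
Qed.

Lemma le_OPT h Rq B : (forall q, perm_eq q (iota 1 (size Rq).-1) -> B <= order_cost h Rq q) ->
  B <= OPT h Rq.
Proof.
move=> hB; rewrite /OPT; set l := permutations _.
have hl q : List.In q l -> B <= order_cost h Rq q.
  move=> hq; apply: hB; rewrite -mem_permutations -/l.
  by elim: (l) hq => //= y s IH [->|/IH]; rewrite inE ?eqxx // => ->; rewrite orbT.
apply: le_foldr_Rmin => //.
(* The list of orders is nonempty, so the start value of the fold is itself the cost of an order. *)
have : iota 1 (size Rq).-1 \in l by rewrite mem_permutations.
by case: (l) hl => //= q s hl _; apply: hl; left.
Qed.

Lemma pairmap_map_in (f g : nat -> nat -> R) (r : nat -> nat) x (p : seq nat) :
  {in x :: p &, forall a b, g (r a) (r b) = f a b} ->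
  pairmap g (r x) [seq r i | i <- p] = pairmap f x p.
Proof.
elim: p x => //= y p IH x H; rewrite H ?inE ?eqxx ?orbT // IH // => a b ha hb.
by apply: H; rewrite inE (ha, hb) orbT.
Qed.

Theorem theorem1 :
  exists c : R, (0 < c)%R /\
  forall (h : nat) (deg : seq nat -> nat) (v0 : seq nat)
         (rs : seq (seq nat * R)) (s : state),
    hst_wf h deg ->
    is_leaf h deg v0 ->
    (forall i, (i < size rs)%N ->
       is_leaf h deg (nth ([::], 0%R) rs i).1 /\ (0 <= (nth ([::], 0%R) rs i).2)%R) ->
    reach h (reqs v0 rs) (init_state v0 rs) s ->
    complete s ->
    (arrow_cost (reqs v0 rs) s <= c * OPT h (reqs v0 rs))%R.
Proof.
exists 29; split; first lra.
move=> h deg v0 rs s _ [_ lv0] leaves r cs.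
set Rq := reqs v0 rs in r *; set n := size rs.
have szR : size Rq = n.+1 by [].
have leaf i : (i <= n)%N -> size (rnode Rq i) = h /\ 0 <= rtime Rq i.
  case: i => [|i] hi; first by split => //; rewrite /rtime /=; lra.
  by have [[_ ?] ?] := leaves i hi.
have [p pp ord] := arrow_order r cs; rewrite -/Rq szR in pp ord.
set o := 0%N :: p in pp ord.
have Uo : uniq o by rewrite (perm_uniq pp) iota_uniq.
have szo : size o = n.+1 by rewrite (perm_size pp) size_iota.
have memo i : (i \in o) = (i <= n)%N by rewrite (perm_mem pp) mem_iota.
have onth k : (nth 0%N o k <= n)%N.
  case: (ltnP k (size o)) => hk; first by rewrite -memo mem_nth.
  by rewrite nth_default.
(* From here on requests are numbered by their rank in the queue [o]. *)
pose V k := rnode Rq (nth 0%N o k); pose t k := rtime Rq (nth 0%N o k).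
pose ts k := learn_time s (nth 0%N o k); pose d a b := dT h (V a) (V b).
have ud : ultrametric d.
  split=> [x y|x y|x|x y z]; [exact: dT_ge0|exact: dT_sym|exact: dT_self|].
  by apply: dT_ultra; apply: (proj1 (leaf _ (onth _))).
have lastk k : (1 <= k <= n)%N -> last 0%N (take k o) = nth 0%N o k.-1.
  case: k => // k hk; rewrite (take_nth 0%N) ?last_rcons // szo ltnS; exact: ltnW.
have tge i : (1 <= i <= n)%N -> t i <= ts i /\ t i.-1 <= ts i.
  move=> hi; have [x [h1 h2 h3 _]] := ord i hi.
  by rewrite /ts /learn_time h1 /t -(lastk i hi).
have tnn i j : (1 <= i)%N -> (i <= j <= n)%N -> ts i <= t j + d j i.-1.
  move=> hi hj; have hin : (1 <= i <= n)%N by lia.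
  have [x [h1 _ _ h4]] := ord i hin.
  rewrite /ts /learn_time h1 /t /d /V -(lastk i hin); apply: h4.
    by rewrite szR ltnS.
  apply/negP => hm; have jo : (j < size o)%N by rewrite szo; lia.
  have io : (i <= size o)%N by rewrite szo; lia.
  have := index_uniq 0%N jo Uo; rewrite -(cat_take_drop i o) index_cat cat_take_drop hm => E.
  by have := hm; rewrite -index_mem E size_takel //; lia.
have -> : arrow_cost Rq s = Rsum [seq ts i - t i | i <- iota 1 n].
  rewrite /arrow_cost szR /=.
  have ppn : perm_eq (iota 1 n) p by have := pp; rewrite /= perm_cons perm_sym.
  rewrite (Rsum_perm _ ppn); congr Rsum.
  have szp : size p = n by move: szo => /= [].
  apply: (@eq_from_nth _ 0); rewrite !size_map szp ?size_iota // => k kn.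
  by rewrite (nth_map 0%N) ?szp // (nth_map 0%N) ?size_iota // nth_iota.
(* Divided by 29, the claim becomes a lower bound on every single order. *)
suff : Rsum [seq ts i - t i | i <- iota 1 n] / 29 <= OPT h Rq by lra.
apply: le_OPT => q; rewrite szR /= => pq.
pose rk i := index i o.
have rkK i : (i <= n)%N -> nth 0%N o (rk i) = i by move=> hi; rewrite nth_index // memo.
have qn : {subset 0%N :: q <= o}.
  move=> i; rewrite memo inE (perm_mem pq) mem_iota => /orP [/eqP ->//|]; lia.
have pr : perm_eq (0%N :: [seq rk i | i <- q]) (iota 0 n.+1).
  have pqo : perm_eq (0%N :: q) o.
    by rewrite perm_sym; apply: (perm_trans pp); rewrite /= perm_cons perm_sym.
  have -> : 0%N :: [seq rk i | i <- q] = [seq rk i | i <- 0%N :: q] by [].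
  apply: perm_trans (perm_map rk pqo) _; apply: uniq_perm; [|exact: (iota_uniq 0 n.+1)|].
    rewrite map_inj_in_uniq // => a b ao bo E.
    by rewrite -[a](nth_index 0%N ao) -[b](nth_index 0%N bo) -/(rk a) -/(rk b) E.
  move=> k; rewrite mem_iota add0n; apply/mapP/idP => [[i io ->]|hk].
    by rewrite /rk -szo index_mem.
  by exists (nth 0%N o k); [rewrite mem_nth // szo|rewrite /rk index_uniq // szo].
have t0 i : (i <= n)%N -> t 0%N <= t i.
  by move=> _; have [_ ] := leaf _ (onth i); rewrite /t {2}/rtime /=.
have main := nn_competitive ud pr t0 tge tnn.
have E : pairmap (fun a b => Rmax (d a b) (t a - t b)) 0%N [seq rk i | i <- q]
    = pairmap (pair_cost h Rq) 0%N q.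
  have -> : 0%N = rk 0%N by [].
  apply: pairmap_map_in => a b /qn ha /qn hb; rewrite memo in ha; rewrite memo in hb.
  by rewrite /pair_cost /d /t /V !rkK.
rewrite E in main; rewrite /order_cost; lra.
Qed.
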